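(* Let $0\leq \beta <1$ and let $f(z)=z+\sum_{n=2}^{\infty} a_n z^n$ be in the class $\mathcal{S}_{\sigma}^{\ast}(\beta)$ of bi-starlike functions of order $\beta$. Then $$\left| a_2 a_4-a_3^2\right| \leq \begin{cases} \dfrac{4}{3}(1-\beta)^2\left(4\beta^2-8\beta+5\right), & \beta\in\left[0,\dfrac{29-\sqrt{137}}{32}\right],\\[2mm] (1-\beta)^2\left(\dfrac{13\beta^2-14\beta-7}{16\beta^2-26\beta+5}\right), & \beta\in\left(\dfrac{29-\sqrt{137}}{32},1\right).\end{cases}$$
   Context: Let $\mathcal{U}=\{z\in\mathbb{C}:|z|<1\}$. Let $\mathcal{A}$ be the family of functions $f$ analytic in $\mathcal{U}$ of the form $f(z)=z+\sum_{n=2}^{\infty}a_n z^n$, and let $\mathcal{S}\subset\mathcal{A}$ be the subclass of functions univalent (injective) in $\mathcal{U}$. Every $f\in\mathcal{S}$ has an inverse $f^{-1}$ satisfying $f^{-1}(f(z))=z$ for $z\in\mathcal{U}$ and $f(f^{-1}(w))=w$ for $|w|<r_0(f)$, where $r_0(f)\geq 1/4$. A function $f\in\mathcal{A}$ is bi-univalent in $\mathcal{U}$ if both $f$ and $f^{-1}$ are univalent in $\mathcal{U}$ (that is, $f$ is univalent in $\mathcal{U}$ and $f^{-1}$, defined near $0$, has an analytic continuation to $\mathcal{U}$, still denoted $f^{-1}$, which is univalent in $\mathcal{U}$); $\sigma$ denotes the class of bi-univalent functions. For $0\leq\beta<1$, the class of starlike functions of order $\beta$ is $\mathcal{S}^{\ast}(\beta)=\{f\in\mathcal{S}:\Re(zf'(z)/f(z))>\beta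 \text{ for all } z\in\mathcal{U}\}$ (with the value of $zf'(z)/f(z)$ at $z=0$ taken to be $1$). A function $f\in\sigma$ belongs to $\mathcal{S}_{\sigma}^{\ast}(\beta)$ (bi-starlike of order $\beta$) if both $f$ and its inverse $f^{-1}$ are starlike of order $\beta$ in $\mathcal{U}$. *)

(* Defs.v *)
From Stdlib Require Import Reals.
From Coquelicot Require Import Coquelicot.
Open Scope R_scope.

Definition in_disc (z : C) : Prop := Cmod z < 1.

Definition analytic_in_disc (f : C -> C) : Prop :=
  forall z : C, in_disc z -> ex_derive (K := C_AbsRing) (V := C_NormedModule) f z.

(* [f z = z + a 2 * z^2 + a 3 * z^3 + ...] on the whole open unit disc;
   values of functions outside the disc are never constrained. *)
Definition normalized_expansion (f : C -> C) (a : nat -> C) : Prop :=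
  a 0%nat = RtoC 0 /\ a 1%nat = RtoC 1 /\
  forall z : C, in_disc z ->
    is_pseries (K := C_AbsRing) (V := C_NormedModule) a z (f z).

Definition class_A (f : C -> C) : Prop :=
  analytic_in_disc f /\ exists a : nat -> C, normalized_expansion f a.

Definition univalent_in_disc (f : C -> C) : Prop :=
  analytic_in_disc f /\
  forall z1 z2 : C, in_disc z1 -> in_disc z2 -> f z1 = f z2 -> z1 = z2.

Definition class_S (f : C -> C) : Prop :=
  class_A f /\ univalent_in_disc f.

(* [g] is an analytic continuation to the disc of the germ at 0 of the inverse
   of [f] restricted to the disc: when [f] is injective on the disc, the last
   two conjuncts say that [g w] is the preimage of [w] in the disc.
   By the identity theorem, such a [g] is unique on the disc. *)
Definition inverse_continuation (f g : C -> C) : Prop :=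
  analytic_in_disc g /\
  exists r : R, 0 < r /\
    forall w : C, in_disc w -> Cmod w < r -> in_disc (g w) /\ f (g w) = w.

Definition bi_univalent (f : C -> C) : Prop :=
  class_A f /\ univalent_in_disc f /\
  exists g : C -> C, inverse_continuation f g /\ univalent_in_disc g.

(* [z * f'(z) / f(z)], extended by its limit 1 at the removable singularity 0. *)
Definition starlike_quotient (f : C -> C) (z : C) : C :=
  if Ceq_dec z (RtoC 0) then RtoC 1 else (z * C_derive f z / f z)%C.

Definition starlike (beta : R) (f : C -> C) : Prop :=
  class_S f /\ forall z : C, in_disc z -> beta < Re (starlike_quotient f z).

Definition bi_starlike (beta : R) (f : C -> C) : Prop :=
  bi_univalent f /\ starlike beta f /\
  exists g : C -> C, inverse_continuation f g /\ starlike beta g.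

(* Main.v *)
Require Import Defs.
From Stdlib Require Import Reals Lra Lia Psatz.
From Coquelicot Require Import Coquelicot.
Open Scope R_scope.

(* Put b = 1 - beta.  The functions (z f'/f - beta)/b and (w g'/g - beta)/b, with
   g the inverse of f, have positive real part; their coefficients c_i and d_i are
   polynomials in a_2, a_3, a_4, and d_1 = - c_1.  Positivity of the Toeplitz forms
   of the c_i and of the d_i gives the Libera-Zlotkiewicz parametrisations
   2 c_2 = c_1^2 + x (4 - |c_1|^2), etc., with parameters in the closed disc.
   Substituting them into a_2 a_4 - a_3^2, the triangle inequality leaves a
   majorant that is quadratic in |c_1|^2 in [0, 4]; its maximum is at the end point
   4 or at the vertex, according to the sign of 16 b^2 - 3 b - 2.

   The Toeplitz form is positive because a holomorphic function with continuous
   derivative on the punctured disc has the same mean on all circles |z| = r. *)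

(** * Power series on the disc *)

(** The obstacle is that z f'/f is a quotient, so the expansion of f does not hand over its
    coefficients. No power series for it is formed: with G = f(z)/z, nonzero off 0 by univalence,
    the quotient f'/G has a continuous derivative away from 0 and is known near 0 up to an error
    O(z^4). That is enough, because each Toeplitz form is a circle mean, evaluated by shrinking the
    radius to 0. Three coefficients are wanted since a_4 first enters c_3; hence forms in four
    variables. The break point comes from t = |c_1|^2 / 4. The majorant is D t^2 / 3 + 2 (b + 1) t +
    1 with D = 16 b^2 - 6 b - 5; its slope is 2 (b + 1) > 0 at t = 0 and 2/3 (16 b^2 - 3 b - 2) at t
    = 1. The positive root b = (3 + sqrt 137) / 32 of the latter is beta = (29 - sqrt 137) / 32. *)

Definition disc_series (a : nat -> C) (F : C -> C) : Prop :=
  forall z : C, in_disc z ->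
    is_pseries (K := C_AbsRing) (V := C_NormedModule) a z (F z).

Lemma pow_n_Cpow (z : C) (n : nat) : pow_n (K := C_AbsRing) z n = (z ^ n)%C.
Proof.
induction n as [|n IH]; [reflexivity|].
simpl. rewrite IH. reflexivity.
Qed.

Lemma disc_series_Cpow (a : nat -> C) (F : C -> C) (z : C) :
  disc_series a F -> in_disc z ->
  is_series (K := C_AbsRing) (V := C_NormedModule) (fun n => a n * z ^ n)%C (F z).
Proof.
intros H Hz. generalize (H z Hz). unfold is_pseries. apply is_series_ext.
intros n. rewrite pow_n_Cpow. unfold scal; simpl. unfold mult; simpl.
apply Cmult_comm.
Qed.

Lemma is_series_Cmod_le (a : nat -> C) (b : nat -> R) (l : C) (B : R) :
  is_series (K := C_AbsRing) (V := C_NormedModule) a l ->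
  is_series b B -> (forall n, Cmod (a n) <= b n) -> Cmod l <= B.
Proof.
intros Ha Hb Hle.
assert (H1 : is_lim_seq (fun n => Cmod (sum_n (G := C_AbelianGroup) a n)) (Cmod l)).
{ unfold is_lim_seq. 
  apply (filterlim_comp _ _ _ (sum_n (G := C_AbelianGroup) a) Cmod eventually
           (locally (T := C_UniformSpace) l) (Rbar_locally (Cmod l))).
  - exact Ha.
  - exact (filterlim_norm (K := C_AbsRing) (V := C_NormedModule) l). }
assert (H2 : is_lim_seq (sum_n b) B) by exact Hb.
refine (is_lim_seq_le _ _ (Cmod l) B _ H1 H2).
intros n. unfold sum_n.
eapply Rle_trans.
- apply (norm_sum_n_m (K := C_AbsRing) (V := C_NormedModule) a 0 n).
- apply sum_n_m_le. exact Hle.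
Qed.

(** The weight absorbs both the factor n of a differentiated term and the factor n^2 of a
    second-order Taylor remainder. *)
Lemma ex_series_square_geom (q : R) : 0 < q < 1 ->
  ex_series (fun n => (INR n + 1) ^ 2 * q ^ n).
Proof.
intros Hq.
assert (Hpos : forall n, 0 < (INR n + 1) ^ 2 * q ^ n).
{ intros n. apply Rmult_lt_0_compat; [|apply pow_lt; lra].
  apply pow_lt. generalize (pos_INR n). lra. }
apply ex_series_ext with (fun n => Rabs ((INR n + 1) ^ 2 * q ^ n)).
{ intros n. apply Rabs_pos_eq. left; apply Hpos. }
apply ex_series_DAlembert with q.
- lra.
- intros n. generalize (Hpos n). lra.
- apply is_lim_seq_ext with (fun n => (1 + / (INR n + 1)) ^ 2 * q).
  { intros n. rewrite Rabs_pos_eq.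
    - rewrite S_INR. change (q ^ S n) with (q * q ^ n). field.
      assert (q ^ n <> 0) by (apply pow_nonzero; lra).
      generalize (pos_INR n). split; [assumption|lra].
    - apply Rlt_le, Rdiv_lt_0_compat; apply Hpos. }
  replace (Finite q) with (Rbar_mult ((1 + 0) ^ 2) q)
    by (simpl; f_equal; ring).
  apply is_lim_seq_scal_r.
  assert (H : is_lim_seq (fun n => 1 + / (INR n + 1)) (1 + 0)).
  { apply is_lim_seq_plus'; [apply is_lim_seq_const|].
    replace (Finite 0) with (Rbar_inv p_infty) by reflexivity.
    apply is_lim_seq_inv; [|discriminate].
    apply is_lim_seq_ext with (fun n => INR (S n)); [intros n; apply S_INR|].
    apply (is_lim_seq_incr_1 INR). apply is_lim_seq_INR. }
  apply is_lim_seq_ext with (fun n => (1 + / (INR n + 1)) * (1 + / (INR n + 1))).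
  { intros n; ring. }
  replace (Finite ((1 + 0) ^ 2)) with (Finite ((1 + 0) * (1 + 0)))
    by (f_equal; ring).
  apply is_lim_seq_mult'; exact H.
Qed.

Lemma in_disc_RtoC (r : R) : 0 <= r < 1 -> in_disc (RtoC r).
Proof. intros H. unfold in_disc. rewrite Cmod_R, Rabs_pos_eq; lra. Qed.

Lemma is_series_bounded (a : nat -> C) (l : C) :
  is_series (K := C_AbsRing) (V := C_NormedModule) a l ->
  exists B, 0 < B /\ forall n, Cmod (a n) <= B.
Proof.
intros H.
destruct (filterlim_bounded (K := C_AbsRing) (V := C_NormedModule)
  (sum_n (G := C_AbelianGroup) a)) as [M HM].
{ exists l. exact H. }
change (forall n, Cmod (sum_n (G := C_AbelianGroup) a n) <= M) in HM.
assert (M0 : 0 <= M) by (eapply Rle_trans; [apply Cmod_ge_0|apply (HM 0%nat)]).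
exists (2 * M + 1). split; [lra|].
intros [|n].
- generalize (HM 0%nat). rewrite sum_O. lra.
- generalize (HM n) (HM (S n)). rewrite sum_Sn. intros H1 H2.
  change (plus (G := C_AbelianGroup)) with Cplus in H2.
  set (s := sum_n (G := C_AbelianGroup) a n) in *.
  replace (a (S n)) with ((s + a (S n)) + - s)%C by ring.
  eapply Rle_trans; [apply Cmod_triangle|]. rewrite Cmod_opp. lra.
Qed.

(** At an intermediate radius [sigma] the terms of the convergent series are bounded, so |a_n| rho^n
    is at most a constant times (rho / sigma)^n, which beats the polynomial weight. *)
Lemma disc_series_summable (a : nat -> C) (F : C -> C) (rho : R) :
  disc_series a F -> 0 < rho < 1 ->
  ex_series (fun n => Cmod (a n) * ((INR n + 1) ^ 2 * rho ^ n)).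
Proof.
intros H Hr.
set (sigma := (1 + rho) / 2).
assert (Hs : 0 < sigma < 1 /\ rho < sigma) by (unfold sigma; lra).
destruct (is_series_bounded _ _ (disc_series_Cpow a F (RtoC sigma) H
  (in_disc_RtoC sigma ltac:(lra)))) as [B [HB Hb]].
apply (ex_series_le (K := R_AbsRing) (V := R_CompleteNormedModule) _
  (fun n => B * ((INR n + 1) ^ 2 * (rho / sigma) ^ n))).
- intros n. change (norm (K := R_AbsRing)) with Rabs.
  assert (H1 := Hb n). rewrite Cmod_mult, Cmod_pow, Cmod_R, Rabs_pos_eq in H1 by lra.
  assert (P1 : 0 < sigma ^ n) by (apply pow_lt; lra).
  assert (P2 : 0 < rho ^ n) by (apply pow_lt; lra).
  assert (P3 : 0 < (INR n + 1) ^ 2).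
  { apply pow_lt. generalize (pos_INR n). lra. }
  change (Rabs (Cmod (a n) * ((INR n + 1) ^ 2 * rho ^ n)) <=
    B * ((INR n + 1) ^ 2 * (rho / sigma) ^ n)).
  rewrite Rabs_pos_eq.
  + unfold Rdiv. rewrite Rpow_mult_distr, pow_inv.
    replace (Cmod (a n) * ((INR n + 1) ^ 2 * rho ^ n)) with
      ((Cmod (a n) * sigma ^ n) * ((INR n + 1) ^ 2 * (rho ^ n * / sigma ^ n)))
      by (field; lra).
    apply Rmult_le_compat_r; [|exact H1].
    apply Rmult_le_pos; [lra|].
    apply Rmult_le_pos; [lra|]. apply Rlt_le, Rinv_0_lt_compat, P1.
  + apply Rmult_le_pos; [apply Cmod_ge_0|]. apply Rmult_le_pos; lra.
- apply (ex_series_scal (K := R_AbsRing) (V := R_NormedModule) B).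
  apply ex_series_square_geom. split.
  + apply Rdiv_lt_0_compat; lra.
  + apply Rlt_div_l; lra.
Qed.

Lemma disc_series_bounded (a : nat -> C) (F : C -> C) (rho : R) :
  disc_series a F -> 0 < rho < 1 ->
  exists K, forall z, Cmod z <= rho -> Cmod (F z) <= K.
Proof.
intros H Hr. destruct (disc_series_summable a F rho H Hr) as [K HK].
exists K. intros z Hz.
refine (is_series_Cmod_le _ _ _ _ (disc_series_Cpow a F z H _) HK _).
- unfold in_disc; lra.
- intros n. rewrite Cmod_mult, Cmod_pow.
  apply Rmult_le_compat_l; [apply Cmod_ge_0|].
  assert (Cmod z ^ n <= rho ^ n) by (apply pow_incr; split; [apply Cmod_ge_0|lra]).
  assert (0 < rho ^ n) by (apply pow_lt; lra).
  assert (1 <= (INR n + 1) ^ 2) by (generalize (pos_INR n); nra).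
  nra.
Qed.

(** At this stage [F'] is only the sum of the differentiated series; that it is the derivative of
    [F] follows from [disc_series_taylor1]. *)
Lemma disc_series_derivative_exists (a : nat -> C) (F : C -> C) :
  disc_series a F ->
  exists F', disc_series (fun n => RtoC (INR (S n)) * a (S n))%C F'.
Proof.
intros H.
assert (E : forall z, in_disc z -> ex_series (K := C_AbsRing) (V := C_NormedModule)
  (fun k => scal (pow_n (K := C_AbsRing) z k) (RtoC (INR (S k)) * a (S k))%C)).
{ intros z Hz. unfold in_disc in Hz.
  set (rho := (1 + Cmod z) / 2).
  assert (Hr : 0 < rho < 1 /\ Cmod z <= rho)
    by (generalize (Cmod_ge_0 z); unfold rho; lra).
  apply (ex_series_le (K := C_AbsRing) (V := C_CompleteNormedModule) _
    (fun n => / rho * (Cmod (a (S n)) * ((INR (S n) + 1) ^ 2 * rho ^ (S n))))).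
  - intros n. 
    change (Cmod (pow_n (K := C_AbsRing) z n * (RtoC (INR (S n)) * a (S n)))
      <= / rho * (Cmod (a (S n)) * ((INR (S n) + 1) ^ 2 * rho ^ (S n)))).
    rewrite pow_n_Cpow, !Cmod_mult, Cmod_pow, Cmod_R, Rabs_pos_eq by apply pos_INR.
    assert (A1 : Cmod z ^ n <= rho ^ n)
      by (apply pow_incr; split; [apply Cmod_ge_0|lra]).
    assert (A2 : 0 < rho ^ n) by (apply pow_lt; lra).
    assert (A3 : 0 <= Cmod z ^ n) by (apply pow_le, Cmod_ge_0).
    assert (A4 := Cmod_ge_0 (a (S n))).
    assert (A5 := pos_INR (S n)).
    replace (/ rho * (Cmod (a (S n)) * ((INR (S n) + 1) ^ 2 * rho ^ S n)))
      with (rho ^ n * ((INR (S n) + 1) ^ 2 * Cmod (a (S n))))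
      by (simpl; field; lra).
    apply Rmult_le_compat; try assumption.
    + apply Rmult_le_pos; assumption.
    + apply Rmult_le_compat_r; [assumption|]. nra.
  - apply (ex_series_scal (K := R_AbsRing) (V := R_NormedModule) (/ rho)).
    apply (ex_series_incr_1 (K := R_AbsRing) (V := R_NormedModule)
      (fun n => Cmod (a n) * ((INR n + 1) ^ 2 * rho ^ n))).
    apply (disc_series_summable a F); [assumption|lra]. }
(* Convergence and uniqueness of limits make [iota] return the sum at each point of the disc. *)
exists (fun z => iota (T := C_CompleteNormedModule)
  (is_pseries (K := C_AbsRing) (V := C_NormedModule)
     (fun n => RtoC (INR (S n)) * a (S n))%C z)).
intros z Hz. apply (iota_correct (V := C_CompleteNormedModule)).
destruct (E z Hz) as [l Hl]. exists l. split; [exact Hl|].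
intros y Hy.
exact (filterlim_locally_unique _ _ _ Hl Hy).
Qed.

(** Induction on r_(n+1) = w r_n + n z^(n-1) (w - z)^2 for the remainders r_n. The crude constant
    n^2 suffices because n^2 + n <= (n + 1)^2; at n = 0 the truncated [pred] is multiplied by
    [INR 0]. *)
Lemma Cpow_taylor1 (z w : C) (rho : R) (n : nat) :
  0 < rho -> Cmod z <= rho -> Cmod w <= rho ->
  Cmod (w ^ n - z ^ n - RtoC (INR n) * z ^ (pred n) * (w - z))%C
    <= (INR n) ^ 2 * rho ^ n * (/ rho ^ 2 * Cmod (w - z)%C ^ 2).
Proof.
intros Hr Hz Hw.
assert (Hd := Cmod_ge_0 (w - z)%C).
induction n as [|n IH].
- simpl. replace (1 - 1 - 0 * 1 * (w - z))%C with (RtoC 0) by ring.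
  rewrite Cmod_0. lra.
- replace (w ^ S n - z ^ S n - RtoC (INR (S n)) * z ^ pred (S n) * (w - z))%C
   with (w * (w ^ n - z ^ n - RtoC (INR n) * z ^ (pred n) * (w - z))
         + RtoC (INR n) * z ^ (pred n) * ((w - z) * (w - z)))%C.
  2: { rewrite S_INR, RtoC_plus. simpl pred. destruct n as [|n].
       - simpl. ring.
       - simpl pred. rewrite !Cpow_S. ring. }
  eapply Rle_trans; [apply Cmod_triangle|].
  rewrite !Cmod_mult, Cmod_pow, Cmod_R, Rabs_pos_eq by apply pos_INR.
  assert (Hp : 0 < rho ^ n) by (apply pow_lt; lra).
  assert (A1 : Cmod w * Cmod (w ^ n - z ^ n - RtoC (INR n) * z ^ (pred n) * (w - z))%C
    <= rho * (INR n ^ 2 * rho ^ n * (/ rho ^ 2 * Cmod (w - z)%C ^ 2))).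
  { apply Rmult_le_compat; try apply Cmod_ge_0; assumption. }
  assert (A2 : INR n * Cmod z ^ pred n * (Cmod (w - z)%C * Cmod (w - z)%C)
    <= INR n * rho ^ S n * (/ rho ^ 2 * Cmod (w - z)%C ^ 2)).
  { destruct n as [|n].
    - simpl. lra.
    - simpl pred.
      replace (INR (S n) * rho ^ S (S n) * (/ rho ^ 2 * Cmod (w - z)%C ^ 2))
        with (INR (S n) * rho ^ n * (Cmod (w - z)%C * Cmod (w - z)%C))
        by (change (rho ^ S (S n)) with (rho * (rho * rho ^ n)); field; lra).
      apply Rmult_le_compat_r; [nra|].
      apply Rmult_le_compat_l; [apply pos_INR|].
      apply pow_incr. split; [apply Cmod_ge_0|assumption]. }
  assert (A3 : 0 <= / rho ^ 2 * Cmod (w - z)%C ^ 2).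
  { apply Rmult_le_pos; [|apply pow2_ge_0].
    apply Rlt_le, Rinv_0_lt_compat, pow_lt, Hr. }
  set (T := / rho ^ 2 * Cmod (w - z)%C ^ 2) in *. clearbody T.
  rewrite S_INR.
  change (rho ^ S n) with (rho * rho ^ n) in *.
  assert (N0 := pos_INR n).
  assert (0 <= rho * rho ^ n * T) by (repeat apply Rmult_le_pos; lra).
  nra.
Qed.

(** Summing the remainders of the monomials gives one constant for all pairs of points in the closed
    disc of radius [rho]. *)
Lemma disc_series_taylor1 (a : nat -> C) (F F' : C -> C) (rho : R) :
  disc_series a F ->
  disc_series (fun n => RtoC (INR (S n)) * a (S n))%C F' ->
  0 < rho < 1 ->
  exists K, forall z w, Cmod z <= rho -> Cmod w <= rho ->
    Cmod (F w - F z - F' z * (w - z))%C <= K * Cmod (w - z)%C ^ 2.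
Proof.
intros H H' Hr.
destruct (disc_series_summable a F rho H Hr) as [K HK].
exists (K * / rho ^ 2). intros z w Hz Hw.
assert (Dz : in_disc z) by (unfold in_disc; lra).
assert (Dw : in_disc w) by (unfold in_disc; lra).
assert (S1 := disc_series_Cpow a F z H Dz).
assert (S2 := disc_series_Cpow a F w H Dw).
(* With [pred n] the series of [F'] is indexed like that of [F]; the extra term at n = 0
   vanishes. *)
assert (S3 : is_series (K := C_AbsRing) (V := C_NormedModule)
  (fun n => RtoC (INR n) * a n * z ^ pred n)%C (F' z)).
{ apply (is_series_decr_1 (K := C_AbsRing) (V := C_NormedModule)).
  match goal with |- is_series _ ?l => replace l with (F' z) end.
  - generalize (disc_series_Cpow _ F' z H' Dz). apply is_series_ext.
    intros n. reflexivity.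
  - change (F' z = F' z + - (RtoC 0 * a 0%nat * 1))%C. ring. }
assert (S4 := is_series_scal (K := C_AbsRing) (V := C_NormedModule) (w - z)%C _ _ S3).
assert (S5 := is_series_minus _ _ _ _ (is_series_minus _ _ _ _ S2 S1) S4).
rewrite Rmult_assoc.
refine (is_series_Cmod_le _ (fun n => (Cmod (a n) * ((INR n + 1) ^ 2 * rho ^ n))
  * (/ rho ^ 2 * Cmod (w - z)%C ^ 2)) (F w - F z - F' z * (w - z))%C _ _ _ _).
- replace (F w - F z - F' z * (w - z))%C with
    (minus (G := C_AbelianGroup) (minus (G := C_AbelianGroup) (F w) (F z))
      (scal (K := C_AbsRing) (V := C_NormedModule) (w - z)%C (F' z))).
  + exact S5.
  + change ((F w + - F z) + - ((w - z) * F' z) = F w - F z - F' z * (w - z))%C. ring.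
- apply (is_series_scal_r (/ rho ^ 2 * Cmod (w - z)%C ^ 2)). exact HK.
- intros n.
  change (Cmod ((a n * w ^ n + - (a n * z ^ n)) +
     - ((w - z) * (RtoC (INR n) * a n * z ^ pred n)))%C
    <= Cmod (a n) * ((INR n + 1) ^ 2 * rho ^ n) * (/ rho ^ 2 * Cmod (w - z)%C ^ 2)).
  replace ((a n * w ^ n + - (a n * z ^ n)) +
     - ((w - z) * (RtoC (INR n) * a n * z ^ pred n)))%C with
   (a n * (w ^ n - z ^ n - RtoC (INR n) * z ^ (pred n) * (w - z)))%C by ring.
  rewrite Cmod_mult, Rmult_assoc.
  apply Rmult_le_compat_l; [apply Cmod_ge_0|].
  eapply Rle_trans; [apply (Cpow_taylor1 z w rho n); lra|].
  apply Rmult_le_compat_r.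
  + apply Rmult_le_pos; [|apply pow2_ge_0].
    apply Rlt_le, Rinv_0_lt_compat, pow_lt; lra.
  + apply Rmult_le_compat_r; [apply pow_le; lra|].
    generalize (pos_INR n). nra.
Qed.

(** * Complex differentiability on the punctured disc *)

(** The uniform structure is the one whose balls are those of [Cmod]. *)
Definition Ccontinuous (F : C -> C) (z : C) : Prop :=
  continuous (T := AbsRing_UniformSpace C_AbsRing)
    (U := AbsRing_UniformSpace C_AbsRing) F z.

Lemma Ccontinuous_eps (F : C -> C) (z : C) :
  Ccontinuous F z <->
  forall eps, 0 < eps -> exists delta, 0 < delta /\
    forall w, Cmod (w - z)%C < delta -> Cmod (F w - F z)%C < eps.
Proof.
split.
- intros H eps He.
  destruct (proj1 (filterlim_locally (U := AbsRing_UniformSpace C_AbsRing)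
    F (F z)) H (mkposreal eps He)) as [d Hd].
  exists d. split; [apply cond_pos|]. intros w Hw. exact (Hd w Hw).
- intros H. apply (filterlim_locally (U := AbsRing_UniformSpace C_AbsRing)).
  intros eps. destruct (H eps (cond_pos eps)) as [d [Hd Hw]].
  exists (mkposreal d Hd). intros w Hw'. exact (Hw w Hw').
Qed.

Lemma Ccontinuous_const (c z : C) : Ccontinuous (fun _ => c) z.
Proof.
exact (continuous_const (U := AbsRing_UniformSpace C_AbsRing)
  (V := AbsRing_UniformSpace C_AbsRing) c z).
Qed.

Lemma Ccontinuous_id (z : C) : Ccontinuous (fun w => w) z.
Proof. exact (continuous_id (U := AbsRing_UniformSpace C_AbsRing) z). Qed.

Lemma Ccontinuous_plus (F G : C -> C) (z : C) :
  Ccontinuous F z -> Ccontinuous G z -> Ccontinuous (fun w => F w + G w)%C z.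
Proof.
exact (continuous_plus (U := AbsRing_UniformSpace C_AbsRing)
  (V := AbsRing_NormedModule C_AbsRing) F G z).
Qed.

Lemma Ccontinuous_mult (F G : C -> C) (z : C) :
  Ccontinuous F z -> Ccontinuous G z -> Ccontinuous (fun w => F w * G w)%C z.
Proof.
exact (continuous_mult (U := AbsRing_UniformSpace C_AbsRing) (K := C_AbsRing) F G z).
Qed.

Lemma Ccontinuous_Cinv (z : C) : z <> 0%C -> Ccontinuous Cinv z.
Proof.
intros Hz. apply Ccontinuous_eps. intros eps He.
assert (Pz : 0 < Cmod z) by (apply Cmod_gt_0; exact Hz).
(* The first bound keeps |w| above |z|/2; the second then keeps |w - z| / (|w| |z|) below eps/2. *)
exists (Rmin (Cmod z / 2) (eps * Cmod z ^ 2 / 4)). split.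
- apply Rmin_glb_lt; [lra|]. assert (0 < Cmod z ^ 2) by (apply pow_lt; lra). nra.
- intros w Hw.
  assert (H1 := Rlt_le_trans _ _ _ Hw (Rmin_l _ _)).
  assert (H2 := Rlt_le_trans _ _ _ Hw (Rmin_r _ _)).
  assert (H3 : Cmod z <= Cmod w + Cmod (w - z)%C).
  { replace z with (w + - (w - z))%C at 1 by ring.
    eapply Rle_trans; [apply Cmod_triangle|]. rewrite Cmod_opp. lra. }
  assert (Pw : 0 < Cmod w) by lra.
  assert (Hw0 : w <> 0%C) by (apply Cmod_gt_0; exact Pw).
  replace (/ w - / z)%C with (- (w - z) / (w * z))%C by (field; split; assumption).
  rewrite Cmod_div, Cmod_opp, Cmod_mult by (apply Cmult_neq_0; assumption).
  apply Rlt_div_l; [nra|]. 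
  assert (eps * (Cmod z / 2 * Cmod z) < eps * (Cmod w * Cmod z)).
  { apply Rmult_lt_compat_l; [lra|]. apply Rmult_lt_compat_r; lra. }
  nra.
Qed.

Lemma Ccontinuous_inv (F : C -> C) (z : C) :
  F z <> 0%C -> Ccontinuous F z -> Ccontinuous (fun w => / F w)%C z.
Proof.
intros Hz HF.
exact (continuous_comp (U := AbsRing_UniformSpace C_AbsRing)
  (V := AbsRing_UniformSpace C_AbsRing) (W := AbsRing_UniformSpace C_AbsRing)
  F Cinv z HF (Ccontinuous_Cinv (F z) Hz)).
Qed.

Definition punctured (z : C) : Prop := 0 < Cmod z < 1.

Lemma punctured_neq_0 (z : C) : punctured z -> z <> 0%C.
Proof. intros [H _]. apply Cmod_gt_0. exact H. Qed.

Lemma punctured_open (z : C) : punctured z ->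
  exists delta, 0 < delta /\ forall w, Cmod (w - z)%C < delta -> punctured w.
Proof.
intros [H0 H1]. exists (Rmin (Cmod z) (1 - Cmod z)). split.
- apply Rmin_glb_lt; lra.
- intros w Hw.
  assert (A1 := Rlt_le_trans _ _ _ Hw (Rmin_l _ _)).
  assert (A2 := Rlt_le_trans _ _ _ Hw (Rmin_r _ _)).
  assert (A3 : Cmod z <= Cmod w + Cmod (w - z)%C).
  { replace z with (w + - (w - z))%C at 1 by ring.
    eapply Rle_trans; [apply Cmod_triangle|]. rewrite Cmod_opp. lra. }
  assert (A4 : Cmod w <= Cmod z + Cmod (w - z)%C).
  { replace w with (z + (w - z))%C at 1 by ring. apply Cmod_triangle. }
  split; lra.
Qed.

(* Caratheodory's form of complex differentiability, on the punctured disc. *)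
Definition holo (F F' : C -> C) : Prop :=
  forall z, punctured z -> exists Phi, Ccontinuous Phi z /\ Phi z = F' z /\
    forall w, punctured w -> F w = (F z + Phi w * (w - z))%C.

(** Continuity of the derivative is what differentiation under the integral sign requires. As the
    origin is left out, terms with a pole at 0 qualify. *)
Definition holo1 (F : C -> C) : Prop :=
  exists F', holo F F' /\ forall z, punctured z -> Ccontinuous F' z.

Lemma holo_continuous (F F' : C -> C) (z : C) :
  holo F F' -> punctured z -> Ccontinuous F z.
Proof.
intros H Hz. destruct (H z Hz) as [Phi [Hc [_ HP]]].
destruct (punctured_open z Hz) as [d [Hd Hw]].
apply (continuous_ext_loc (T := AbsRing_UniformSpace C_AbsRing)
  (U := AbsRing_UniformSpace C_AbsRing) _ (fun w => F z + Phi w * (w + - z))%C).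
- exists (mkposreal d Hd). intros w Hw'. symmetry. apply HP, Hw. exact Hw'.
- apply Ccontinuous_plus; [apply Ccontinuous_const|].
  apply Ccontinuous_mult; [exact Hc|].
  apply Ccontinuous_plus; [apply Ccontinuous_id|apply Ccontinuous_const].
Qed.

Lemma holo1_const (c : C) : holo1 (fun _ => c).
Proof.
exists (fun _ => 0%C). split; [|intros; apply Ccontinuous_const].
intros z Hz. exists (fun _ => 0%C). repeat split; [apply Ccontinuous_const|].
intros w _. ring.
Qed.

Lemma holo1_id : holo1 (fun z => z).
Proof.
exists (fun _ => 1%C). split; [|intros; apply Ccontinuous_const].
intros z Hz. exists (fun _ => 1%C). repeat split; [apply Ccontinuous_const|].
intros w _. ring.
Qed.

Lemma holo1_plus (F G : C -> C) : holo1 F -> holo1 G -> holo1 (fun z => F z + G z)%C.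
Proof.
intros [F' [HF CF]] [G' [HG CG]]. exists (fun z => F' z + G' z)%C. split.
- intros z Hz. destruct (HF z Hz) as [P [P1 [P2 P3]]].
  destruct (HG z Hz) as [Q [Q1 [Q2 Q3]]].
  exists (fun w => P w + Q w)%C. repeat split.
  + apply Ccontinuous_plus; assumption.
  + rewrite P2, Q2. reflexivity.
  + intros w Hw. rewrite (P3 w Hw), (Q3 w Hw). ring.
- intros z Hz. apply Ccontinuous_plus; auto.
Qed.

Lemma holo1_mult (F G : C -> C) : holo1 F -> holo1 G -> holo1 (fun z => F z * G z)%C.
Proof.
intros [F' [HF CF]] [G' [HG CG]]. exists (fun z => F' z * G z + F z * G' z)%C. split.
- intros z Hz. destruct (HF z Hz) as [P [P1 [P2 P3]]].
  destruct (HG z Hz) as [Q [Q1 [Q2 Q3]]].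
  exists (fun w => P w * G w + F z * Q w)%C. repeat split.
  + apply Ccontinuous_plus; apply Ccontinuous_mult; try assumption.
    * exact (holo_continuous G G' z HG Hz).
    * apply Ccontinuous_const.
  + rewrite P2, Q2. reflexivity.
  + intros w Hw. rewrite (P3 w Hw), (Q3 w Hw). ring.
- intros z Hz. apply Ccontinuous_plus; apply Ccontinuous_mult; auto.
  + exact (holo_continuous G G' z HG Hz).
  + exact (holo_continuous F F' z HF Hz).
Qed.

Lemma holo1_inv (F : C -> C) : holo1 F -> (forall z, punctured z -> F z <> 0%C) ->
  holo1 (fun z => / F z)%C.
Proof.
intros [F' [HF CF]] N. exists (fun z => (- (1)) * F' z * / (F z * F z))%C. split.
- intros z Hz. destruct (HF z Hz) as [P [P1 [P2 P3]]].
  exists (fun w => (- (1)) * P w * / (F w * F z))%C. repeat split.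
  + assert (CFz := holo_continuous F F' z HF Hz).
    apply Ccontinuous_mult.
    * apply Ccontinuous_mult; [apply Ccontinuous_const|exact P1].
    * apply (Ccontinuous_inv (fun w => F w * F z)%C).
      -- apply Cmult_neq_0; auto.
      -- apply Ccontinuous_mult; [exact CFz|apply Ccontinuous_const].
  + rewrite P2. reflexivity.
  + intros w Hw. assert (E : (P w * (w - z) = F w - F z)%C)
      by (rewrite (P3 w Hw); ring).
    replace (- (1) * P w * / (F w * F z) * (w - z))%C with
      (- (P w * (w - z)) * / (F w * F z))%C by ring.
    rewrite E. field. split; auto.
- intros z Hz. assert (CFz := holo_continuous F F' z HF Hz).
  apply Ccontinuous_mult.
  + apply Ccontinuous_mult; [apply Ccontinuous_const|auto].
  + apply (Ccontinuous_inv (fun w => F w * F w)%C).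
    * apply Cmult_neq_0; auto.
    * apply Ccontinuous_mult; exact CFz.
Qed.

Lemma holo1_pow (F : C -> C) (n : nat) : holo1 F -> holo1 (fun z => F z ^ n)%C.
Proof.
intros H. induction n as [|n IH].
- exact (holo1_const 1).
- exact (holo1_mult F _ H IH).
Qed.

Lemma disc_series_holo (a : nat -> C) (F F' : C -> C) :
  disc_series a F ->
  disc_series (fun n => RtoC (INR (S n)) * a (S n))%C F' ->
  holo F F'.
Proof.
intros H H' z [Hz0 Hz1].
(* The slope is the difference quotient completed at w = z; its continuity there is the quadratic
   remainder divided by |w - z|. *)
exists (fun w => if Ceq_dec w z then F' z else (F w - F z) / (w - z))%C.
repeat split.
- apply Ccontinuous_eps. intros eps He.
  set (rho := (1 + Cmod z) / 2).
  assert (Hr : 0 < rho < 1 /\ Cmod z < rho) by (unfold rho; lra).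
  destruct (disc_series_taylor1 a F F' rho H H' (proj1 Hr)) as [K HK].
  assert (K0 : 0 <= Rabs K) by apply Rabs_pos.
  exists (Rmin (rho - Cmod z) (eps / (Rabs K + 1))). split.
  + apply Rmin_glb_lt; [lra|]. apply Rdiv_lt_0_compat; lra.
  + intros w Hw.
    assert (A1 := Rlt_le_trans _ _ _ Hw (Rmin_l _ _)).
    assert (A2 := Rlt_le_trans _ _ _ Hw (Rmin_r _ _)).
    destruct (Ceq_dec z z) as [_|N]; [|congruence].
    destruct (Ceq_dec w z) as [->|N].
    { replace (F' z - F' z)%C with (RtoC 0) by ring. rewrite Cmod_0. lra. }
    assert (N' : (w - z)%C <> 0%C).
    { intros E. apply N. replace w with ((w - z) + z)%C by ring. rewrite E. ring. }
    assert (A4 : Cmod w <= Cmod z + Cmod (w - z)%C).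
    { replace w with (z + (w - z))%C at 1 by ring. apply Cmod_triangle. }
    replace ((F w - F z) / (w - z) - F' z)%C with
      ((F w - F z - F' z * (w - z)) / (w - z))%C by (field; exact N').
    rewrite Cmod_div by exact N'.
    assert (Pd : 0 < Cmod (w - z)%C) by (apply Cmod_gt_0; exact N').
    apply Rlt_div_l; [exact Pd|].
    eapply Rle_lt_trans; [apply HK; lra|].
    apply Rlt_div_r in A2; [|lra].
    assert (K <= Rabs K) by apply Rle_abs.
    nra.
- destruct (Ceq_dec z z); congruence.
- intros w Hw. destruct (Ceq_dec w z) as [->|N]; [ring|].
  field. intros E. apply N. replace w with ((w - z) + z)%C by ring. rewrite E. ring.
Qed.

(** The series is differentiated twice: existence of the second derivative makes the first
    continuous. *)
Lemma disc_series_holo1 (a : nat -> C) (F : C -> C) : disc_series a F -> holo1 F.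
Proof.
intros H. destruct (disc_series_derivative_exists a F H) as [F' H'].
destruct (disc_series_derivative_exists _ F' H') as [F'' H''].
exists F'. split; [exact (disc_series_holo a F F' H H')|].
intros z Hz. exact (holo_continuous F' F'' z (disc_series_holo _ F' F'' H' H'') Hz).
Qed.

Lemma disc_series_C_derive (a : nat -> C) (F F' : C -> C) (z : C) :
  disc_series a F ->
  disc_series (fun n => RtoC (INR (S n)) * a (S n))%C F' ->
  in_disc z -> C_derive F z = F' z.
Proof.
intros H H' Hz. unfold in_disc in Hz. apply is_C_derive_unique.
split; [apply is_linear_scal_l|].
intros x Hx.
rewrite <- (is_filter_lim_locally_unique (K := C_AbsRing)
  (V := AbsRing_NormedModule C_AbsRing) z x Hx).
intros eps.
set (rho := (1 + Cmod z) / 2).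
assert (Hr : 0 < rho < 1 /\ Cmod z < rho)
  by (generalize (Cmod_ge_0 z); unfold rho; lra).
destruct (disc_series_taylor1 a F F' rho H H' (proj1 Hr)) as [K HK].
assert (K0 : 0 <= Rabs K) by apply Rabs_pos.
assert (Hd : 0 < Rmin (rho - Cmod z) (eps / (Rabs K + 1))).
{ apply Rmin_glb_lt; [lra|]. apply Rdiv_lt_0_compat; [apply cond_pos|lra]. }
exists (mkposreal _ Hd). intros w Hw.
change (Cmod (w - z)%C < Rmin (rho - Cmod z) (eps / (Rabs K + 1))) in Hw.
assert (A1 := Rlt_le_trans _ _ _ Hw (Rmin_l _ _)).
assert (A2 := Rlt_le_trans _ _ _ Hw (Rmin_r _ _)).
assert (A4 : Cmod w <= Cmod z + Cmod (w - z)%C).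
{ replace w with (z + (w - z))%C at 1 by ring. apply Cmod_triangle. }
change (Cmod (F w - F z - (w - z) * F' z)%C <= eps * Cmod (w - z)%C).
rewrite (Cmult_comm (w - z)).
eapply Rle_trans; [apply HK; lra|].
apply Rlt_div_r in A2; [|lra].
assert (K <= Rabs K) by apply Rle_abs.
assert (0 <= Cmod (w - z)%C) by apply Cmod_ge_0.
nra.
Qed.

(** * Circle means *)

Lemma Cmod_le_Rabs (x y : R) : Cmod (x, y) <= Rabs x + Rabs y.
Proof.
replace ((x, y) : C) with (RtoC x + Ci * RtoC y)%C.
- eapply Rle_trans; [apply Cmod_triangle|].
  rewrite Cmod_mult, Cmod_Ci, !Cmod_R. lra.
- unfold RtoC, Ci, Cplus, Cmult; simpl. f_equal; ring.
Qed.

(** [T] is general so as to serve both curves and, in [continuity_2d_radial], functions of radius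
    and angle jointly. *)
Lemma continuous_Re_comp (T : UniformSpace) (Phi : C -> C) (x y : T -> R) (t : T) :
  Ccontinuous Phi (x t, y t) -> continuous x t -> continuous y t ->
  continuous (fun s => Re (Phi (x s, y s))) t.
Proof.
intros HP Hx Hy.
apply filterlim_locally. intros eps.
destruct (proj1 (Ccontinuous_eps _ _) HP eps (cond_pos eps)) as [d [Hd HP']].
assert (Hd2 : 0 < d / 2) by lra.
generalize (filter_and _ _
  (proj1 (filterlim_locally _ _) Hx (mkposreal _ Hd2))
  (proj1 (filterlim_locally _ _) Hy (mkposreal _ Hd2))).
apply filter_imp. intros s [Bx By].
change (Rabs (x s - x t) < d / 2) in Bx. change (Rabs (y s - y t) < d / 2) in By.
change (Rabs (Re (Phi (x s, y s)) - Re (Phi (x t, y t))) < eps).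
replace (Re (Phi (x s, y s)) - Re (Phi (x t, y t))) with
  (Re (Phi (x s, y s) - Phi (x t, y t))%C)
  by (unfold Cminus; rewrite re_plus, re_opp; ring).
eapply Rle_lt_trans; [apply re_le_Cmod|]. apply HP'.
eapply Rle_lt_trans; [apply (Cmod_le_Rabs (x s - x t) (y s - y t))|]. lra.
Qed.

(** The usual product rule does not apply, [A] being only continuous at t; that the other factor
    vanishes at t makes up for it. *)
Lemma is_derive_caratheodory (A x : R -> R) (t x' : R) :
  continuous A t -> is_derive x t x' ->
  is_derive (fun s => A s * (x s - x t)) t (A t * x').
Proof.
intros HA Hx.
apply is_derive_Reals. apply is_derive_Reals in Hx.
intros eps He.
assert (B0 : 0 <= Rabs (A t)) by apply Rabs_pos.
assert (B1 : 0 <= Rabs x') by apply Rabs_pos.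
assert (He1 : 0 < Rmin 1 (eps / (2 * (Rabs (A t) + 1)))).
{ apply Rmin_glb_lt; [lra|]. apply Rdiv_lt_0_compat; lra. }
assert (He2 : 0 < eps / (2 * (Rabs x' + 1))) by (apply Rdiv_lt_0_compat; lra).
destruct (Hx _ He1) as [d1 Hd1].
destruct (proj1 (filterlim_locally _ _) HA (mkposreal _ He2)) as [d2 Hd2].
assert (Hd : 0 < Rmin d1 d2) by (apply Rmin_glb_lt; apply cond_pos).
exists (mkposreal _ Hd). intros h Hh0 Hh. simpl in Hh.
assert (C1 := Hd1 h Hh0 (Rlt_le_trans _ _ _ Hh (Rmin_l _ _))).
assert (C2 : Rabs (A (t + h) - A t) < eps / (2 * (Rabs x' + 1))).
{ apply (Hd2 (t + h)). change (Rabs (t + h - t) < d2).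
  replace (t + h - t) with h by ring.
  exact (Rlt_le_trans _ _ _ Hh (Rmin_r _ _)). }
set (q := (x (t + h) - x t) / h) in *.
replace ((A (t + h) * (x (t + h) - x t) - A t * (x t - x t)) / h - A t * x') with
  ((A (t + h) - A t) * q + A t * (q - x')) by (unfold q; field; exact Hh0).
assert (C3 := Rlt_le_trans _ _ _ C1 (Rmin_l _ _)).
assert (C4 := Rlt_le_trans _ _ _ C1 (Rmin_r _ _)).
assert (C5 : Rabs q <= Rabs x' + 1).
{ replace q with (x' + (q - x')) by ring.
  eapply Rle_trans; [apply Rabs_triang|]. lra. }
eapply Rle_lt_trans; [apply Rabs_triang|]. rewrite !Rabs_mult.
apply Rlt_div_r in C2; [|lra]. apply Rlt_div_r in C4; [|lra].
assert (0 <= Rabs (A (t + h) - A t)) by apply Rabs_pos.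
assert (0 <= Rabs (q - x')) by apply Rabs_pos.
nra.
Qed.

(** The increment Re (Phi (dx + i dy)) splits into Re (Phi) dx + Re (Phi i) dy, two products of the
    kind treated by [is_derive_caratheodory]. *)
Lemma is_derive_Re_holo (F F' : C -> C) (x y : R -> R) (t x' y' : R) :
  holo F F' -> punctured (x t, y t) ->
  is_derive x t x' -> is_derive y t y' ->
  is_derive (fun s => Re (F (x s, y s))) t (Re (F' (x t, y t) * (x', y'))%C).
Proof.
intros HF Hp Hx Hy.
destruct (HF _ Hp) as [Phi [Hc [HP HE]]].
assert (Cx : continuous x t) by (apply (ex_derive_continuous x); exists x'; exact Hx).
assert (Cy : continuous y t) by (apply (ex_derive_continuous y); exists y'; exact Hy).
set (A := fun s => Re (Phi (x s, y s))).
set (B := fun s => Re ((Phi (x s, y s)) * Ci)%C).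
apply is_derive_ext_loc with
  (fun s => Re (F (x t, y t)) + (A s * (x s - x t) + B s * (y s - y t))).
- destruct (punctured_open _ Hp) as [d [Hd Hop]].
  assert (Hd2 : 0 < d / 2) by lra.
  generalize (filter_and _ _
    (proj1 (filterlim_locally _ _) Cx (mkposreal _ Hd2))
    (proj1 (filterlim_locally _ _) Cy (mkposreal _ Hd2))).
  apply filter_imp. intros s [Bx By].
  change (Rabs (x s - x t) < d / 2) in Bx. change (Rabs (y s - y t) < d / 2) in By.
  assert (Hs : punctured (x s, y s)).
  { apply Hop. eapply Rle_lt_trans; [apply (Cmod_le_Rabs (x s - x t) (y s - y t))|]. lra. }
  rewrite (HE _ Hs). rewrite re_plus, re_mult. unfold A, B. rewrite re_mult.
  simpl. ring.
- replace (Re (F' (x t, y t) * (x', y'))%C) with (0 + (A t * x' + B t * y')).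
  2: { unfold A, B. rewrite HP, !re_mult. simpl. ring. }
  apply (is_derive_plus (V := R_NormedModule)).
  + apply (is_derive_const (V := R_NormedModule)).
  + apply (is_derive_plus (V := R_NormedModule)).
    * apply is_derive_caratheodory; [|exact Hx].
      apply continuous_Re_comp; assumption.
    * apply is_derive_caratheodory; [|exact Hy].
      apply (continuous_Re_comp R_UniformSpace (fun z => Phi z * Ci)%C); try assumption.
      apply Ccontinuous_mult; [assumption|apply Ccontinuous_const].
Qed.

Definition circ (r t : R) : C := (r * cos t, r * sin t).

Lemma Cmod_circ (r t : R) : 0 <= r -> Cmod (circ r t) = r.
Proof.
intros Hr. unfold Cmod, circ; simpl fst; simpl snd.
replace ((r * cos t) ^ 2 + (r * sin t) ^ 2) with (r ^ 2).
- apply sqrt_pow2. exact Hr.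
- generalize (sin2_cos2 t). unfold Rsqr. intros H.
  replace ((r * cos t) ^ 2 + (r * sin t) ^ 2) with
    (r ^ 2 * (sin t * sin t + cos t * cos t)) by ring.
  rewrite H. ring.
Qed.

Lemma punctured_circ (r t : R) : 0 < r < 1 -> punctured (circ r t).
Proof. intros Hr. unfold punctured. rewrite Cmod_circ; lra. Qed.

(** Real parts keep the integrals real; imaginary parts are reached by multiplying [F] by -i. *)
Definition circle_int (F : C -> C) (r : R) : R :=
  RInt (fun t => Re (F (circ r t))) 0 (2 * PI).

Lemma continuous_Re_circ (F : C -> C) (r t : R) :
  Ccontinuous F (circ r t) -> continuous (fun t => Re (F (circ r t))) t.
Proof.
intros H.
apply (continuous_Re_comp R_UniformSpace F (fun t => r * cos t) (fun t => r * sin t)).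
- exact H.
- apply (ex_derive_continuous (fun t => r * cos t)). auto_derive. exact I.
- apply (ex_derive_continuous (fun t => r * sin t)). auto_derive. exact I.
Qed.

Lemma ex_RInt_circ (F : C -> C) (r : R) :
  0 < r < 1 -> (forall z, punctured z -> Ccontinuous F z) ->
  ex_RInt (fun t => Re (F (circ r t))) 0 (2 * PI).
Proof.
intros Hr HF. apply (ex_RInt_continuous (V := R_CompleteNormedModule)).
intros t _. apply continuous_Re_circ, HF, punctured_circ, Hr.
Qed.

Lemma holo1_continuous (F : C -> C) (z : C) : holo1 F -> punctured z -> Ccontinuous F z.
Proof. intros [F' [H _]]. exact (holo_continuous F F' z H). Qed.

Lemma is_derive_circ_radius (F F' : C -> C) (r t : R) :
  holo F F' -> 0 < r < 1 ->
  is_derive (fun u => Re (F (circ u t))) r (Re (F' (circ r t) * (cos t, sin t))%C).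
Proof.
intros HF Hr.
apply (is_derive_Re_holo F F' (fun u => u * cos t) (fun u => u * sin t)).
- exact HF.
- apply (punctured_circ r t Hr).
- auto_derive; [exact I|ring].
- auto_derive; [exact I|ring].
Qed.

(* The radial derivative of F is, up to the factor i r, its angular derivative. *)
Lemma circle_int_radial_derivative (F F' : C -> C) (r : R) :
  holo F F' -> (forall z, punctured z -> Ccontinuous F' z) -> 0 < r < 1 ->
  is_RInt (fun t => Re (F' (circ r t) * (cos t, sin t))%C) 0 (2 * PI) 0.
Proof.
intros HF CF Hr.
(* Since d/dt F(r e^(it)) = i r e^(it) F', the function -i F / r has angular derivative e^(it) F',
   which is the radial derivative of F. Its integral over a full turn vanishes by periodicity. *)
assert (HG : holo (fun z => - Ci * F z)%C (fun z => - Ci * F' z)%C).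
{ intros z Hz. destruct (HF z Hz) as [P [P1 [P2 P3]]].
  exists (fun w => - Ci * P w)%C. repeat split.
  - apply Ccontinuous_mult; [apply Ccontinuous_const|exact P1].
  - rewrite P2. reflexivity.
  - intros w Hw. rewrite (P3 w Hw). ring. }
apply (is_RInt_ext (V := R_NormedModule)
  (fun t => scal (/ r) (Re (- Ci * F' (circ r t) * ((- r * sin t)%R, (r * cos t)%R))%C))).
{ intros t _. unfold scal; simpl. unfold mult; simpl. field. lra. }
replace 0 with (scal (V := R_NormedModule) (/ r)
   (minus (Re (- Ci * F (circ r (2 * PI)))%C) (Re (- Ci * F (circ r 0))%C))) at 2.
2: { unfold circ. rewrite cos_2PI, sin_2PI, cos_0, sin_0.
     unfold minus, plus, opp, scal; simpl. unfold mult; simpl. ring. }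
apply (is_RInt_scal (V := R_NormedModule)).
apply (is_RInt_derive (V := R_CompleteNormedModule)
  (fun t => Re (- Ci * F (circ r t))%C)).
- intros t _.
  apply (is_derive_Re_holo _ _ (fun t => r * cos t) (fun t => r * sin t) t
    (- r * sin t) (r * cos t) HG).
  + apply (punctured_circ r t Hr).
  + auto_derive; [exact I|ring].
  + auto_derive; [exact I|ring].
- intros t _.
  apply (continuous_ext (fun t =>
    Re ((fun z => - Ci * F' z * (Ci * z))%C (circ r t)))).
  + intros s. f_equal. unfold circ. f_equal.
    unfold Ci, Cmult; simpl. f_equal; ring.
  + apply (continuous_Re_circ (fun z => - Ci * F' z * (Ci * z))%C).
    assert (C0 := CF _ (punctured_circ r t Hr)).
    apply Ccontinuous_mult; apply Ccontinuous_mult;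
      first [apply Ccontinuous_const|apply Ccontinuous_id|exact C0].
Qed.

Lemma continuity_2d_radial (F' : C -> C) (r t : R) :
  Ccontinuous F' (circ r t) ->
  continuity_2d_pt (fun u v => Re (F' (circ u v) * (cos v, sin v))%C) r t.
Proof.
intros H. apply continuity_2d_pt_filterlim.
assert (X : continuous (fun p : R * R => fst p * cos (snd p)) (r, t)).
{ apply (continuous_mult (K := R_AbsRing) (fun p : R * R => fst p) (fun p => cos (snd p))).
  - apply continuous_fst.
  - apply continuous_comp; [apply continuous_snd|apply continuous_cos]. }
assert (Y : continuous (fun p : R * R => fst p * sin (snd p)) (r, t)).
{ apply (continuous_mult (K := R_AbsRing) (fun p : R * R => fst p) (fun p => sin (snd p))).
  - apply continuous_fst.
  - apply continuous_comp; [apply continuous_snd|apply continuous_sin]. }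
assert (A := continuous_Re_comp _ F' _ _ (r, t) H X Y).
assert (B := continuous_Re_comp _ (fun z => F' z * Ci)%C _ _ (r, t)
  (Ccontinuous_mult _ _ _ H (Ccontinuous_const Ci _)) X Y).
change (continuous (fun p : R * R =>
  Re (F' (circ (fst p) (snd p)) * (cos (snd p), sin (snd p)))%C) (r, t)).
apply (continuous_ext (U := R_UniformSpace)
  (fun p : R * R => Re (F' (circ (fst p) (snd p))) * cos (snd p) +
     Re (F' (circ (fst p) (snd p)) * Ci)%C * sin (snd p))).
{ intros p. rewrite !re_mult. simpl. ring. }
apply (continuous_plus (V := R_NormedModule)).
- apply (continuous_mult (K := R_AbsRing)); [exact A|].
  apply continuous_comp; [apply continuous_snd|apply continuous_cos].
- apply (continuous_mult (K := R_AbsRing)); [exact B|].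
  apply continuous_comp; [apply continuous_snd|apply continuous_sin].
Qed.

Lemma is_derive_circle_int (F : C -> C) (r : R) :
  holo1 F -> 0 < r < 1 -> is_derive (circle_int F) r 0.
Proof.
intros H1 Hr. destruct H1 as [F' [HF CF]].
assert (Hd : 0 < Rmin r (1 - r)) by (apply Rmin_glb_lt; lra).
assert (Near : forall u, Rabs (u - r) < Rmin r (1 - r) -> 0 < u < 1).
{ intros u Hu.
  assert (A1 := Rlt_le_trans _ _ _ Hu (Rmin_l _ _)).
  assert (A2 := Rlt_le_trans _ _ _ Hu (Rmin_r _ _)).
  apply Rabs_def2 in A1. apply Rabs_def2 in A2. lra. }
replace 0 with (RInt (fun t => Derive (fun u => Re (F (circ u t))) r) 0 (2 * PI)).
- apply (is_derive_RInt_param (fun u t => Re (F (circ u t)))).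
  + exists (mkposreal _ Hd). intros u Hu t _.
    eexists. apply (is_derive_circ_radius F F' u t HF). apply Near. exact Hu.
  + intros t _.
    apply continuity_2d_pt_ext_loc with
      (fun u v => Re (F' (circ u v) * (cos v, sin v))%C).
    * exists (mkposreal _ Hd). intros u v Hu _. symmetry.
      apply is_derive_unique. apply (is_derive_circ_radius F F' u v HF).
      apply Near. exact Hu.
    * apply continuity_2d_radial. apply CF. apply punctured_circ. exact Hr.
  + exists (mkposreal _ Hd). intros u Hu. apply ex_RInt_circ.
    * apply Near. exact Hu.
    * intros z Hz. exact (holo_continuous F F' z HF Hz).
- transitivity (RInt (fun t => Re (F' (circ r t) * (cos t, sin t))%C) 0 (2 * PI)).
  + apply RInt_ext. intros t _. apply is_derive_unique.
    apply (is_derive_circ_radius F F' r t HF Hr).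
  + apply is_RInt_unique. exact (circle_int_radial_derivative F F' r HF CF Hr).
Qed.

Lemma circle_int_constant (F : C -> C) (r s : R) :
  holo1 F -> 0 < r < 1 -> 0 < s < 1 -> circle_int F r = circle_int F s.
Proof.
intros HF Hr Hs.
destruct (Rtotal_order r s) as [H|[->|H]]; [|reflexivity|symmetry];
  apply (eq_is_derive (V := R_NormedModule)); try exact H;
  intros t Ht; apply is_derive_circle_int; try assumption; lra.
Qed.

Lemma circle_int_plus (F G : C -> C) (r : R) :
  0 < r < 1 -> holo1 F -> holo1 G ->
  circle_int (fun z => F z + G z)%C r = circle_int F r + circle_int G r.
Proof.
intros Hr HF HG. unfold circle_int.
rewrite <- (RInt_plus (V := R_CompleteNormedModule)
  (fun t => Re (F (circ r t))) (fun t => Re (G (circ r t)))).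
- apply RInt_ext. intros t _. apply re_plus.
- apply ex_RInt_circ; [exact Hr|]. intros z Hz. apply holo1_continuous; assumption.
- apply ex_RInt_circ; [exact Hr|]. intros z Hz. apply holo1_continuous; assumption.
Qed.

Lemma holo1_inv_pow (e : C) (k : nat) : holo1 (fun z => e * / z ^ k)%C.
Proof.
apply holo1_mult; [apply holo1_const|].
apply (holo1_inv (fun z => z ^ k)%C).
- apply holo1_pow, holo1_id.
- intros z Hz. apply Cpow_nz, punctured_neq_0, Hz.
Qed.

(* The integral does not depend on r, but is homogeneous of degree - k in r. *)
Lemma circle_int_inv_pow (e : C) (k : nat) (r : R) :
  (0 < k)%nat -> 0 < r < 1 -> circle_int (fun z => e * / z ^ k)%C r = 0.
Proof.
intros Hk Hr. set (F := fun z => (e * / z ^ k)%C).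
assert (HF : holo1 F) by apply holo1_inv_pow.
assert (E1 := circle_int_constant F (r / 2) r HF ltac:(lra) Hr).
assert (E2 : circle_int F (r / 2) = 2 ^ k * circle_int F r).
{ unfold circle_int.
  rewrite <- (RInt_scal (V := R_CompleteNormedModule) (fun t => Re (F (circ r t)))).
  - apply RInt_ext. intros t _. unfold F.
    replace (circ (r / 2) t) with (/ RtoC 2 * circ r t)%C.
    + rewrite Cpow_mult_l, Cpow_inv by (intros E; apply RtoC_inj in E; lra).
      rewrite <- RtoC_pow.
      assert (P2 : RtoC (2 ^ k) <> 0%C)
        by (intros E; apply RtoC_inj in E; revert E; apply pow_nonzero; lra).
      assert (Pc : (circ r t ^ k <> 0)%C)
        by (apply Cpow_nz, punctured_neq_0, punctured_circ, Hr).
      replace (e * / (/ RtoC (2 ^ k) * circ r t ^ k))%C with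
        (RtoC (2 ^ k) * (e * / (circ r t ^ k)))%C by (field; split; assumption).
      rewrite re_scal_l. reflexivity.
    + unfold circ. rewrite <- RtoC_inv by lra. unfold RtoC, Cmult; simpl. f_equal; field.
  - apply ex_RInt_circ; [exact Hr|]. intros z Hz. apply holo1_continuous; assumption. }
assert (2 <= 2 ^ k).
{ destruct k as [|k]; [lia|]. simpl. assert (1 <= 2 ^ k) by (apply pow_R1_Rle; lra). lra. }
assert ((2 ^ k - 1) * circle_int F r = 0) by lra.
nra.
Qed.

Lemma circle_int_bound (F : C -> C) (r K : R) :
  holo1 F -> 0 < r < 1 -> (forall z, Cmod z = r -> Cmod (F z) <= K) ->
  Rabs (circle_int F r) <= 2 * PI * K.
Proof.
intros HF Hr HK. replace (2 * PI * K) with ((2 * PI - 0) * K) by ring.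
unfold circle_int. apply abs_RInt_le_const.
- generalize PI_RGT_0. lra.
- apply ex_RInt_circ; [exact Hr|]. intros z Hz. apply holo1_continuous; assumption.
- intros t _. eapply Rle_trans; [apply re_le_Cmod|]. apply HK. apply Cmod_circ. lra.
Qed.

(** Once the principal part and the constant are subtracted, the rest is O(z) and differentiable off
    0, so its integral is independent of the radius and tends to 0 with it. Poles up to order 3
    occur because the test polynomial will be cubic. *)
Lemma circle_int_laurent (F : C -> C) (e0 e1 e2 e3 : C) (K delta r : R) :
  holo1 F -> 0 < delta ->
  (forall z, 0 < Cmod z < delta ->
    Cmod (F z - (e0 * / z ^ 3 + e1 * / z ^ 2 + e2 * / z ^ 1 + e3))%C <= K * Cmod z) ->
  0 < r < 1 ->
  circle_int F r = 2 * PI * Re e3.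
Proof.
intros HF Hd HK Hr.
set (P := fun z => (e0 * / z ^ 3 + e1 * / z ^ 2 + e2 * / z ^ 1 + e3)%C).
set (E := fun z => (F z + (- (1)) * P z)%C).
assert (HP : holo1 P).
{ unfold P. repeat apply holo1_plus; try apply holo1_inv_pow. apply holo1_const. }
assert (HE : holo1 E).
{ apply holo1_plus; [exact HF|]. apply holo1_mult; [apply holo1_const|exact HP]. }
assert (IP : circle_int P r = 2 * PI * Re e3).
{ unfold P. 
  rewrite (circle_int_plus (fun z => e0 * / z ^ 3 + e1 * / z ^ 2 + e2 * / z ^ 1)%C
    (fun _ => e3)), (circle_int_plus (fun z => e0 * / z ^ 3 + e1 * / z ^ 2)%C
    (fun z => e2 * / z ^ 1)%C), (circle_int_plus (fun z => e0 * / z ^ 3)%C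
    (fun z => e1 * / z ^ 2)%C), !circle_int_inv_pow;
    try exact Hr; try lia; repeat apply holo1_plus;
    try apply holo1_inv_pow; try apply holo1_const.
  unfold circle_int. rewrite RInt_const. unfold scal; simpl. unfold mult; simpl. ring. }
assert (IE : circle_int E r = 0).
{ apply cond_eq. intros eps He. rewrite Rminus_0_r.
  assert (K0 : 0 <= Rabs K) by apply Rabs_pos.
  assert (PI0 := PI_RGT_0).
  set (s := Rmin (1 / 2) (Rmin (delta / 2) (eps / (4 * PI * (Rabs K + 1))))).
  assert (D : 0 < 4 * PI * (Rabs K + 1)) by (apply Rmult_lt_0_compat; lra).
  assert (Hs : 0 < s).
  { unfold s. repeat apply Rmin_glb_lt; try lra. apply Rdiv_lt_0_compat; lra. }
  assert (Hs1 : s <= 1 / 2) by apply Rmin_l.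
  assert (Hs2 : s <= delta / 2) by (eapply Rle_trans; [apply Rmin_r|apply Rmin_l]).
  assert (Hs3 : s <= eps / (4 * PI * (Rabs K + 1)))
    by (eapply Rle_trans; [apply Rmin_r|apply Rmin_r]).
  rewrite (circle_int_constant E r s HE Hr) by lra.
  eapply Rle_lt_trans.
  - apply (circle_int_bound E s (Rabs K * s) HE); [lra|].
    intros z Hz. unfold E. replace (F z + (- (1)) * P z)%C with (F z - P z)%C by ring.
    eapply Rle_trans; [apply HK; lra|]. rewrite Hz.
    apply Rmult_le_compat_r; [lra|]. apply Rle_abs.
  - apply Rle_div_r in Hs3; [|exact D].
    assert (2 * PI * (Rabs K * s) <= 2 * PI * ((Rabs K + 1) * s)).
    { apply Rmult_le_compat_l; [lra|]. apply Rmult_le_compat_r; lra. }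
    assert (s * (4 * PI * (Rabs K + 1)) = 2 * (2 * PI * ((Rabs K + 1) * s))) by ring.
    lra. }
assert (IF : circle_int F r = circle_int (fun z => E z + P z)%C r).
{ unfold circle_int. apply RInt_ext. intros t _. f_equal. unfold E. ring. }
rewrite IF, circle_int_plus by assumption. lra.
Qed.

(** * Expansions at 0 *)

(** The origin is excluded: the functions to be expanded are quotients with no prescribed value
    there. *)
Definition bigO (n : nat) (G : C -> C) : Prop :=
  exists K delta, 0 < delta /\
    forall z, 0 < Cmod z < delta -> Cmod (G z) <= K * Cmod z ^ n.

Lemma bigO_ext (n : nat) (F G : C -> C) :
  (forall z, punctured z -> F z = G z) -> bigO n F -> bigO n G.
Proof.
intros E [K [d [Hd H]]]. exists K, (Rmin d 1). split; [apply Rmin_glb_lt; lra|].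
intros z [Hz0 Hz1].
assert (A1 := Rlt_le_trans _ _ _ Hz1 (Rmin_l _ _)).
assert (A2 := Rlt_le_trans _ _ _ Hz1 (Rmin_r _ _)).
rewrite <- E by (split; assumption). apply H; lra.
Qed.

Lemma bigO_plus (n : nat) (F G : C -> C) :
  bigO n F -> bigO n G -> bigO n (fun z => F z + G z)%C.
Proof.
intros [K [d [Hd H]]] [L [e [He H']]].
exists (K + L), (Rmin d e). split; [apply Rmin_glb_lt; lra|].
intros z [Hz0 Hz1].
assert (A1 := Rlt_le_trans _ _ _ Hz1 (Rmin_l _ _)).
assert (A2 := Rlt_le_trans _ _ _ Hz1 (Rmin_r _ _)).
eapply Rle_trans; [apply Cmod_triangle|].
assert (B1 := H z ltac:(lra)). assert (B2 := H' z ltac:(lra)). lra.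
Qed.

Lemma bigO_mult (n m : nat) (F G : C -> C) :
  bigO n F -> bigO m G -> bigO (n + m) (fun z => F z * G z)%C.
Proof.
intros [K [d [Hd H]]] [L [e [He H']]].
exists (K * L), (Rmin d e). split; [apply Rmin_glb_lt; lra|].
intros z [Hz0 Hz1].
assert (A1 := Rlt_le_trans _ _ _ Hz1 (Rmin_l _ _)).
assert (A2 := Rlt_le_trans _ _ _ Hz1 (Rmin_r _ _)).
rewrite Cmod_mult, pow_add.
replace (K * L * (Cmod z ^ n * Cmod z ^ m)) with
  ((K * Cmod z ^ n) * (L * Cmod z ^ m)) by ring.
apply Rmult_le_compat; try apply Cmod_ge_0; [apply H|apply H']; lra.
Qed.

Lemma bigO_const (c : C) : bigO 0 (fun _ => c).
Proof. exists (Cmod c), 1. split; [lra|]. intros z _. simpl. lra. Qed.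

Lemma bigO_pow (n : nat) : bigO n (fun z => z ^ n)%C.
Proof. exists 1, 1. split; [lra|]. intros z _. rewrite Cmod_pow. lra. Qed.

Lemma bigO_weaken (n m : nat) (F : C -> C) : (m <= n)%nat -> bigO n F -> bigO m F.
Proof.
intros Hnm [K [d [Hd H]]]. exists (Rabs K), (Rmin d 1).
split; [apply Rmin_glb_lt; lra|]. intros z [Hz0 Hz1].
assert (A1 := Rlt_le_trans _ _ _ Hz1 (Rmin_l _ _)).
assert (A2 := Rlt_le_trans _ _ _ Hz1 (Rmin_r _ _)).
eapply Rle_trans; [apply H; lra|].
replace n with (m + (n - m))%nat by lia. rewrite pow_add.
assert (P1 : 0 < Cmod z ^ m) by (apply pow_lt; lra).
assert (P2 : 0 < Cmod z ^ (n - m)) by (apply pow_lt; lra).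
assert (P3 : Cmod z ^ (n - m) <= 1).
{ rewrite <- (pow1 (n - m)). apply pow_incr. lra. }
assert (K <= Rabs K) by apply Rle_abs. assert (0 <= Rabs K) by apply Rabs_pos.
assert (Cmod z ^ m * Cmod z ^ (n - m) <= Cmod z ^ m) by nra.
assert (0 < Cmod z ^ m * Cmod z ^ (n - m)) by nra.
nra.
Qed.

Lemma bigO_0_mult (F G : C -> C) : bigO 0 F -> bigO 0 G -> bigO 0 (fun z => F z * G z)%C.
Proof. exact (bigO_mult 0 0 F G). Qed.

Lemma bigO_0_id : bigO 0 (fun z => z).
Proof.
apply (bigO_weaken 1); [lia|]. apply (bigO_ext 1 (fun z => z ^ 1)%C).
- intros; simpl; ring.
- apply bigO_pow.
Qed.

Lemma bigO_0_pow (n : nat) : bigO 0 (fun z => z ^ n)%C.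
Proof. apply (bigO_weaken n); [lia|apply bigO_pow]. Qed.

Ltac bigO_poly := repeat first
  [ apply bigO_const | apply bigO_0_id | apply bigO_0_pow
  | apply bigO_plus | apply bigO_0_mult ].

Lemma bigO_pow_mult (n : nat) (F : C -> C) : bigO 0 F -> bigO n (fun z => z ^ n * F z)%C.
Proof.
intros H. replace n with (n + 0)%nat at 1 by lia.
apply bigO_mult; [apply bigO_pow|exact H].
Qed.

Lemma bigO_0_mult_r (n : nat) (F G : C -> C) :
  bigO n F -> bigO 0 G -> bigO n (fun z => F z * G z)%C.
Proof.
intros H H'. replace n with (n + 0)%nat by lia. apply bigO_mult; assumption.
Qed.

Lemma bigO_div_pow (n k : nat) (F : C -> C) :
  bigO (k + n) (fun z => z ^ k * F z)%C -> bigO n F.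
Proof.
intros [K [d [Hd H]]]. exists K, d. split; [exact Hd|]. intros z Hz.
specialize (H z Hz). rewrite Cmod_mult, Cmod_pow, pow_add in H.
assert (0 < Cmod z ^ k) by (apply pow_lt; lra).
apply Rmult_le_reg_l with (Cmod z ^ k); [assumption|]. lra.
Qed.

(** Near 0 the modulus of [G] exceeds 1/2, so 2 bounds the inverse. *)
Lemma bigO_0_inv (G : C -> C) : bigO 1 (fun z => G z + - (1))%C -> bigO 0 (fun z => / G z)%C.
Proof.
intros [K [d [Hd H]]].
assert (K0 : 0 <= Rabs K) by apply Rabs_pos.
exists 2, (Rmin d (/ (2 * (Rabs K + 1)))). split.
- apply Rmin_glb_lt; [exact Hd|]. apply Rinv_0_lt_compat. lra.
- intros z [Hz0 Hz1].
  assert (A1 := Rlt_le_trans _ _ _ Hz1 (Rmin_l _ _)).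
  assert (A2 := Rlt_le_trans _ _ _ Hz1 (Rmin_r _ _)).
  specialize (H z (conj Hz0 A1)). rewrite pow_1 in H.
  assert (A3 : Cmod z * (2 * (Rabs K + 1)) < 1).
  { apply Rmult_lt_reg_r with (/ (2 * (Rabs K + 1))).
    - apply Rinv_0_lt_compat. lra.
    - rewrite Rmult_assoc, Rinv_r by lra. lra. }
  assert (K <= Rabs K) by apply Rle_abs.
  assert (A4 : 1 <= Cmod (G z) + Cmod (G z + - (1))%C).
  { generalize (Cmod_triangle (G z) (- (G z + - (1)))%C).
    replace (G z + - (G z + - (1)))%C with (RtoC 1) by ring.
    rewrite Cmod_opp, Cmod_1. auto. }
  assert (A5 : / 2 < Cmod (G z)) by nra.
  rewrite Cmod_inv by (apply Cmod_gt_0; lra). simpl. rewrite Rmult_1_r.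
  rewrite <- (Rinv_inv 2). apply Rlt_le, Rinv_lt_contravar; [apply Rmult_lt_0_compat; lra|exact A5].
Qed.

Lemma disc_series_decr (a : nat -> C) (F : C -> C) :
  disc_series a F -> exists G, disc_series (fun n => a (S n)) G /\
    forall z, in_disc z -> F z = (a 0%nat + z * G z)%C.
Proof.
intros H.
assert (H0 : F 0%C = a 0%nat).
{ assert (D0 : in_disc 0%C) by (unfold in_disc; rewrite Cmod_0; lra).
  exact (filterlim_locally_unique _ _ _ (H 0%C D0)
    (is_pseries_0 (K := C_AbsRing) (V := C_NormedModule) a)). }
(* At 0 the division would be meaningless; [a 1] is the value of the shifted series there. *)
exists (fun z => if Ceq_dec z 0 then a 1%nat else / z * (F z - a 0%nat))%C. split.
- intros z Hz. destruct (Ceq_dec z 0) as [->|N].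
  + exact (is_pseries_0 (K := C_AbsRing) (V := C_NormedModule) (fun n => a (S n))).
  + exact (is_pseries_decr_1 (K := C_AbsRing) (V := C_NormedModule) a z (/ z)%C (F z)
      (Cinv_l z N) (H z Hz)).
- intros z Hz. destruct (Ceq_dec z 0) as [->|N].
  + rewrite H0. ring.
  + field. exact N.
Qed.

Lemma disc_series_bigO_0 (a : nat -> C) (F : C -> C) : disc_series a F -> bigO 0 F.
Proof.
intros H. destruct (disc_series_bounded a F (1 / 2) H ltac:(lra)) as [K HK].
exists K, (1 / 2). split; [lra|]. intros z Hz. simpl. rewrite Rmult_1_r. apply HK. lra.
Qed.

Lemma disc_series_expansion (a : nat -> C) (F : C -> C) :
  disc_series a F ->
  bigO 5 (fun z => F z + - (a 0%nat + a 1%nat * z + a 2%nat * z ^ 2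
                             + a 3%nat * z ^ 3 + a 4%nat * z ^ 4))%C.
Proof.
intros H.
destruct (disc_series_decr _ _ H) as [G1 [H1 E1]].
destruct (disc_series_decr _ _ H1) as [G2 [H2 E2]].
destruct (disc_series_decr _ _ H2) as [G3 [H3 E3]].
destruct (disc_series_decr _ _ H3) as [G4 [H4 E4]].
destruct (disc_series_decr _ _ H4) as [G5 [H5 E5]].
apply (bigO_ext 5 (fun z => z ^ 5 * G5 z)%C).
- intros z [_ Hz]. rewrite E1, E2, E3, E4, E5 by exact Hz. ring.
- apply bigO_pow_mult. exact (disc_series_bigO_0 _ _ H5).
Qed.

(** * Functions with positive real part *)

(* Half the Hermitian form of the Toeplitz matrix with diagonal 2 and
   subdiagonals c1, c2, c3. *)
Definition toeplitz_form (c1 c2 c3 m0 m1 m2 m3 : C) : R :=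
  Re (m0 * Cconj m0 + m1 * Cconj m1 + m2 * Cconj m2 + m3 * Cconj m3
      + c1 * (m0 * Cconj m1 + m1 * Cconj m2 + m2 * Cconj m3)
      + c2 * (m0 * Cconj m2 + m1 * Cconj m3) + c3 * (m0 * Cconj m3))%C.

Lemma Cconj_RtoC (x : R) : Cconj (RtoC x) = RtoC x.
Proof. unfold Cconj, RtoC; simpl. f_equal. ring. Qed.

Lemma Re_mult_Cconj (z : C) : Re (z * Cconj z)%C = Cmod z ^ 2.
Proof. rewrite <- Cmod2_conj. apply re_RtoC. Qed.

Lemma Re_scal_mult_Cconj (p w : C) : Re (p * (w * Cconj w))%C = Re p * Cmod w ^ 2.
Proof. rewrite <- Cmod2_conj. apply re_scal_r. Qed.

(** The passage r -> 1, made explicit: 1 - (1 - e)^k <= 3 e for k <= 3, so a negative value S at 1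
    would persist at r = 1 - e once e is small against -S. *)
Lemma nonneg_at_1 (A0 A1 A2 A3 : R) :
  (forall r, 0 < r < 1 -> 0 <= A0 + r * A1 + r ^ 2 * A2 + r ^ 3 * A3) ->
  0 <= A0 + A1 + A2 + A3.
Proof.
intros H. apply Rnot_lt_le. intros Hneg.
set (S := A0 + A1 + A2 + A3) in *.
set (B := Rabs A1 + Rabs A2 + Rabs A3).
assert (B0 : 0 <= B) by (unfold B; generalize (Rabs_pos A1) (Rabs_pos A2) (Rabs_pos A3); lra).
set (e := Rmin (1 / 2) (- S / (4 * (B + 1)))).
assert (He : 0 < e) by (apply Rmin_glb_lt; [lra|]; apply Rdiv_lt_0_compat; lra).
assert (He1 : e <= 1 / 2) by apply Rmin_l.
assert (He2 : e <= - S / (4 * (B + 1))) by apply Rmin_r.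
apply Rle_div_r in He2; [|lra].
assert (G := H (1 - e) ltac:(lra)).
assert (T : forall A c, 0 <= c <= 3 * e -> - (c * A) <= 3 * e * Rabs A).
{ intros A c Hc. generalize (Rle_abs (- A)) (Rabs_pos A). rewrite Rabs_Ropp. nra. }
assert (T1 := T A1 e ltac:(lra)).
assert (T2 := T A2 (1 - (1 - e) ^ 2) ltac:(nra)).
assert (T3 := T A3 (1 - (1 - e) ^ 3) ltac:(simpl; split; nra)).
assert (G' : 0 <= S + 3 * e * B) by (unfold S, B; lra).
nra.
Qed.

(* On |z| = r the conjugate of z is r^2/z, so Re p |Lambda|^2, for Lambda a cubic
   polynomial, is the real part of a holomorphic function with a pole at 0. *)
Lemma caratheodory_toeplitz (p : C -> C) (c1 c2 c3 : C) :
  holo1 p -> (forall z, punctured z -> 0 <= Re (p z)) ->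
  bigO 4 (fun z => p z + - (1 + c1 * z + c2 * z ^ 2 + c3 * z ^ 3))%C ->
  forall m0 m1 m2 m3, 0 <= toeplitz_form c1 c2 c3 m0 m1 m2 m3.
Proof.
intros Hp Pp HO m0 m1 m2 m3.
assert (HR : forall r, 0 < r < 1 ->
  0 <= Re (m0 * Cconj m0 + m1 * Cconj m1 + m2 * Cconj m2 + m3 * Cconj m3)%C
     + r * Re (c1 * (m0 * Cconj m1 + m1 * Cconj m2 + m2 * Cconj m3))%C
     + r ^ 2 * Re (c2 * (m0 * Cconj m2 + m1 * Cconj m3))%C
     + r ^ 3 * Re (c3 * (m0 * Cconj m3))%C).
{ intros r Hr.
  set (R0 := RtoC r).
  assert (R0n : R0 <> 0%C) by (intros E; apply RtoC_inj in E; lra).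
  (* The weights r^(-j) in [L] and r^j in [Ls] leave the diagonal terms free of r and put r^k in
     front of c_k; on |z| = r, [Ls] is the conjugate of [L]. *)
  set (q0 := m0). set (q1 := (m1 * / R0)%C).
  set (q2 := (m2 * / R0 ^ 2)%C). set (q3 := (m3 * / R0 ^ 3)%C).
  set (s0 := Cconj m0). set (s1 := (Cconj m1 * R0)%C).
  set (s2 := (Cconj m2 * R0 ^ 2)%C). set (s3 := (Cconj m3 * R0 ^ 3)%C).
  set (L := fun z => (q0 + q1 * z + q2 * z ^ 2 + q3 * z ^ 3)%C).
  set (Ls := fun z => (s0 + s1 * / z ^ 1 + s2 * / z ^ 2 + s3 * / z ^ 3)%C).
  set (F := fun z => (p z * (L z * Ls z))%C).
  (* [g0] to [g3] are the Taylor coefficients of p L up to z^3, [h] collects the higher ones of the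
     cubic part of p times L, and [e3] is the constant term of p L Ls. *)
  set (g0 := q0). set (g1 := (q1 + c1 * q0)%C).
  set (g2 := (q2 + c1 * q1 + c2 * q0)%C).
  set (g3 := (q3 + c1 * q2 + c2 * q1 + c3 * q0)%C).
  set (h := fun z => ((c1 * q3 + c2 * q2 + c3 * q1) + (c2 * q3 + c3 * q2) * z
     + c3 * q3 * z ^ 2)%C).
  set (e3 := (s0 * g0 + s1 * g1 + s2 * g2 + s3 * g3)%C).
  assert (HL : holo1 L).
  { unfold L. repeat apply holo1_plus; try apply holo1_mult;
    first [apply holo1_const|apply holo1_id|apply holo1_pow, holo1_id]. }
  assert (HLs : holo1 Ls).
  { unfold Ls. repeat apply holo1_plus; first [apply holo1_const|apply holo1_inv_pow]. }
  assert (HF : holo1 F) by (repeat apply holo1_mult; assumption).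
  assert (EX : bigO 1 (fun z => F z - (s3 * g0 * / z ^ 3
      + (s2 * g0 + s3 * g1) * / z ^ 2 + (s1 * g0 + s2 * g1 + s3 * g2) * / z ^ 1 + e3))%C).
  (* Multiplication by z^3 clears the pole, and the claim becomes an O(z^4) estimate. *)
  { apply (bigO_div_pow 1 3).
    apply (bigO_ext 4 (fun z =>
      (p z + - (1 + c1 * z + c2 * z ^ 2 + c3 * z ^ 3))
         * (L z * (s3 + s2 * z + s1 * z ^ 2 + s0 * z ^ 3))
      + z ^ 4 * (h z * (s3 + s2 * z + s1 * z ^ 2 + s0 * z ^ 3)
         + g3 * (s2 + s1 * z + s0 * z ^ 2) + g2 * (s1 + s0 * z) + g1 * s0))%C).
    - intros z Hz. apply punctured_neq_0 in Hz.
      unfold F, L, Ls, h, e3, g0, g1, g2, g3. simpl. field. exact Hz.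
    - apply bigO_plus.
      + apply bigO_0_mult_r; [exact HO|]. unfold L. bigO_poly.
      + apply bigO_pow_mult. unfold h. bigO_poly. }
  destruct EX as [K [d [Hd HK]]].
  assert (I := circle_int_laurent F _ _ _ _ K d r HF Hd
    (fun z Hz => eq_ind _ (fun x => _ <= K * x) (HK z Hz) _ (pow_1 _)) Hr).
  assert (I0 : 0 <= circle_int F r).
  { apply RInt_ge_0.
    - generalize PI_RGT_0. lra.
    - apply ex_RInt_circ; [exact Hr|]. intros z Hz. apply holo1_continuous; assumption.
    - intros t _. set (z := circ r t).
      assert (Hz : punctured z) by (apply punctured_circ; exact Hr).
      assert (Ez : (R0 * R0 = z * Cconj z)%C).
      { rewrite <- Cmod2_conj. unfold z. rewrite Cmod_circ by lra.
        unfold R0. rewrite <- RtoC_mult. f_equal. ring. }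
      assert (Zn := punctured_neq_0 z Hz).
      assert (Ez' : (/ z = Cconj z * / (R0 * R0))%C)
        by (rewrite Ez; field; split; [|exact Zn];
            intros E; apply Zn; rewrite <- (Cconj_conj z), E; apply Cconj_RtoC).
      assert (ELs : Ls z = Cconj (L z)).
      { unfold Ls, L. rewrite !Cplus_conj, !Cmult_conj, !Cpow_conj.
        unfold q0, q1, q2, q3. rewrite !Cmult_conj.
        rewrite <- !Cpow_inv by first [exact Zn|exact R0n].
        rewrite !Cpow_conj, !Cinv_conj by exact R0n.
        unfold R0. rewrite !Cconj_RtoC. fold R0. rewrite Ez'.
        unfold s0, s1, s2, s3. simpl. field. exact R0n. }
      unfold F. rewrite ELs, Re_scal_mult_Cconj.
      apply Rmult_le_pos; [apply Pp, Hz|apply pow2_ge_0]. }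
  rewrite I in I0.
  assert (I1 : 0 <= Re e3).
  { generalize PI_RGT_0. intros P. apply Rnot_lt_le. intros N. nra. }
  replace e3 with ((m0 * Cconj m0 + m1 * Cconj m1 + m2 * Cconj m2 + m3 * Cconj m3)
     + RtoC r * (c1 * (m0 * Cconj m1 + m1 * Cconj m2 + m2 * Cconj m3))
     + RtoC (r ^ 2) * (c2 * (m0 * Cconj m2 + m1 * Cconj m3))
     + RtoC (r ^ 3) * (c3 * (m0 * Cconj m3)))%C in I1.
  - rewrite !re_plus, !re_scal_l in I1. rewrite !re_plus. exact I1.
  - unfold e3, g0, g1, g2, g3, s0, s1, s2, s3, q0, q1, q2, q3.
    rewrite !RtoC_pow. fold R0. field. exact R0n. }
apply nonneg_at_1 in HR. unfold toeplitz_form.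
rewrite !(re_plus (_ + _ + _ + _ + _ + _)), !(re_plus (_ + _ + _ + _ + _)),
  (re_plus (_ + _ + _ + _)). exact HR.
Qed.

(** The test vector u = 1, s = -B / |B| turns the cross term into -|B|. *)
Lemma hermitian_2x2_bound (A : R) (B : C) :
  (forall u s : C, 0 <= A * (Re (u * Cconj u)%C + Re (s * Cconj s)%C)
                      + Re (B * (u * Cconj s))%C) ->
  Cmod B <= 2 * A.
Proof.
intros H. destruct (Ceq_dec B 0) as [->|N].
- rewrite Cmod_0. generalize (H 1%C 0%C). simpl. lra.
- assert (P : 0 < Cmod B) by (apply Cmod_gt_0; exact N).
  assert (Pn : RtoC (Cmod B) <> 0%C) by (intros E; apply RtoC_inj in E; lra).
  generalize (H 1%C (- (B * / RtoC (Cmod B)))%C).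
  assert (E2 := Re_mult_Cconj B).
  replace (B * (1 * Cconj (- (B * / RtoC (Cmod B)))))%C with
    (RtoC (- / Cmod B) * (B * Cconj B))%C.
  + rewrite (re_scal_l (- / Cmod B)), E2, !Re_mult_Cconj, Cmod_1, Cmod_opp, Cmod_mult, Cmod_inv by exact Pn.
    rewrite Cmod_R, Rabs_pos_eq by lra.
    replace (Cmod B * / Cmod B) with 1 by (field; lra).
    replace (- / Cmod B * Cmod B ^ 2) with (- Cmod B) by (field; lra). lra.
  + rewrite Copp_conj, Cmult_conj, Cinv_conj, Cconj_RtoC by exact Pn.
    rewrite RtoC_opp, RtoC_inv by lra. ring.
Qed.

Ltac Cre := unfold toeplitz_form, Re, Im, Cconj, Cplus, Cmult, Copp, Cminus, RtoC; simpl; ring.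

(* The test vectors are those minimising the form for given extreme entries u and s;
   the minimum is a form in (u, s) alone, whose cross term is bounded by the diagonal. *)
Lemma libera_zlotkiewicz (a c2 c3 : C) :
  (forall m0 m1 m2 m3, 0 <= toeplitz_form (2 * a) c2 c3 m0 m1 m2 m3) ->
  Cmod a <= 1 /\
  exists x Z : C, Cmod x <= 1 /\
    Cmod Z <= 2 * (1 - Cmod a ^ 2) * (1 - Cmod x ^ 2) /\
    c2 = (2 * a ^ 2 + 2 * RtoC (1 - Cmod a ^ 2) * x)%C /\
    c3 = (2 * a ^ 3 + 4 * RtoC (1 - Cmod a ^ 2) * a * x
          - 2 * RtoC (1 - Cmod a ^ 2) * Cconj a * x ^ 2 + Z)%C.
Proof.
intros H.
assert (Ha : Cmod a <= 1).
{ assert (Cmod (2 * a)%C <= 2 * 1).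
  { apply hermitian_2x2_bound. intros u s. generalize (H u s 0%C 0%C).
    match goal with |- 0 <= ?x -> 0 <= ?y => replace y with x; [auto|] end. Cre. }
  rewrite Cmod_mult, Cmod_R, Rabs_pos_eq in H0; lra. }
split; [exact Ha|].
set (m := 1 - Cmod a ^ 2).
assert (Em : m = 1 - Re (a * Cconj a)%C) by (unfold m; rewrite Re_mult_Cconj; reflexivity).
assert (B2 : Cmod (c2 - 2 * a ^ 2)%C <= 2 * m).
{ apply hermitian_2x2_bound. intros u s.
  generalize (H u (- (a * u) - Cconj a * s)%C s 0%C).
  match goal with |- 0 <= ?x -> 0 <= ?y => replace y with x; [auto|] end.
  rewrite Em. Cre. }
assert (Hm : 0 <= m) by (generalize (Cmod_ge_0 (c2 - 2 * a ^ 2)%C); lra).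
assert (X : exists x, Cmod x <= 1 /\ c2 = (2 * a ^ 2 + 2 * RtoC m * x)%C).
{ destruct (Req_dec m 0) as [E|N].
  (* When |a| = 1 the estimate forces c_2 = 2 a^2, and any x in the disc would do. *)
  - exists 0%C. rewrite Cmod_0. split; [lra|].
    rewrite E in *. replace c2 with (c2 - 2 * a ^ 2 + 2 * a ^ 2)%C by ring.
    rewrite (Cmod_eq_0 (c2 - 2 * a ^ 2)%C); [ring|].
    generalize (Cmod_ge_0 (c2 - 2 * a ^ 2)%C). lra.
  - assert (Nm : RtoC (2 * m) <> 0%C) by (intros E; apply RtoC_inj in E; lra).
    exists ((c2 - 2 * a ^ 2) / RtoC (2 * m))%C. split.
    + rewrite Cmod_div, (Cmod_R (2 * m)), Rabs_pos_eq by (exact Nm || lra).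
      apply Rle_div_l; lra.
    + rewrite RtoC_mult. field. intros E. apply RtoC_inj in E. lra. }
destruct X as [x [Hx Ex]].
exists x. 
(* Taking for [Z] the whole residue, not divided by its bound, spares a second case distinction. *)
exists (c3 - (2 * a ^ 3 + 4 * RtoC m * a * x - 2 * RtoC m * Cconj a * x ^ 2))%C.
repeat split; [exact Hx| |exact Ex|ring].
(* With the middle entries eliminated, the diagonal becomes m (1 - |x|^2) and the cross term is
   [Z]. *)
rewrite Rmult_assoc. apply hermitian_2x2_bound. intros u s.
generalize (H u (u * (- a + x * Cconj a) - Cconj x * s)%C
  (- (x * u) + s * (- Cconj a + Cconj x * a))%C s).
match goal with |- 0 <= ?y -> 0 <= ?z => replace z with y; [auto|] end.
rewrite <- (Re_mult_Cconj x), Ex, Em. clear.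
destruct a as [a1 a2], x as [x1 x2], c3 as [c31 c32], u as [u1 u2], s as [s1 s2].
Cre.
Qed.

(** * Coefficients of bi-starlike functions *)

Lemma normalized_expansion_disc_series (f : C -> C) (a : nat -> C) :
  normalized_expansion f a -> disc_series a f.
Proof. intros [_ [_ H]]. exact H. Qed.

Lemma normalized_expansion_0 (f : C -> C) (a : nat -> C) :
  normalized_expansion f a -> f 0%C = 0%C.
Proof.
intros H. destruct (disc_series_decr a f) as [G [_ E]].
- apply normalized_expansion_disc_series, H.
- destruct H as [H0 _]. rewrite E, H0 by (unfold in_disc; rewrite Cmod_0; lra). ring.
Qed.

(** The value 0 is already taken at the origin. This is what makes f(z)/z invertible off 0. *)
Lemma univalent_neq_0 (f : C -> C) (a : nat -> C) (z : C) :
  normalized_expansion f a -> univalent_in_disc f -> punctured z -> f z <> 0%C.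
Proof.
intros Hn [_ Hi] Hz E. apply (punctured_neq_0 z Hz). apply Hi.
- apply Hz.
- unfold in_disc. rewrite Cmod_0. lra.
- rewrite E. symmetry. exact (normalized_expansion_0 f a Hn).
Qed.

Lemma bigO_0_scal_const (n : nat) (c : C) (F : C -> C) :
  bigO n F -> bigO n (fun z => F z * c)%C.
Proof. intros H. apply bigO_0_mult_r; [exact H|apply bigO_const]. Qed.

(** The three left-hand sides are the coefficients of z, z^2, z^3 in z f'/f, and [s] is half the
    first coefficient of the normalised quotient. *)
Lemma starlike_coefficients (beta : R) (f : C -> C) (a : nat -> C) :
  beta < 1 -> starlike beta f -> normalized_expansion f a ->
  exists s x Z : C, Cmod s <= 1 /\ Cmod x <= 1 /\
    Cmod Z <= 2 * (1 - Cmod s ^ 2) * (1 - Cmod x ^ 2) /\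
    a 2%nat = (RtoC (1 - beta) * (2 * s))%C /\
    (2 * a 3%nat - a 2%nat ^ 2 = RtoC (1 - beta)
       * (2 * s ^ 2 + 2 * RtoC (1 - Cmod s ^ 2) * x))%C /\
    (3 * a 4%nat - 3 * a 2%nat * a 3%nat + a 2%nat ^ 3 = RtoC (1 - beta)
       * (2 * s ^ 3 + 4 * RtoC (1 - Cmod s ^ 2) * s * x
          - 2 * RtoC (1 - Cmod s ^ 2) * Cconj s * x ^ 2 + Z))%C.
Proof.
intros Hb [[_ Hu] Hst] Ha.
assert (Df := normalized_expansion_disc_series f a Ha).
destruct (disc_series_derivative_exists a f Df) as [f' Df'].
destruct (disc_series_decr a f Df) as [G [DG EG]].
destruct (disc_series_decr _ _ DG) as [G2 [DG2 EG2]].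
assert (A0 := proj1 Ha). assert (A1 := proj1 (proj2 Ha)). simpl in EG2.
assert (EfG : forall z, punctured z -> f z = (z * G z)%C).
{ intros z [_ Hz]. rewrite EG, A0 by exact Hz. ring. }
assert (NG : forall z, punctured z -> G z <> 0%C).
{ intros z Hz E. apply (univalent_neq_0 f a z Ha Hu Hz).
  rewrite EfG, E by exact Hz. ring. }
set (b := RtoC (1 - beta)).
assert (Nb : b <> 0%C) by (intros E; apply RtoC_inj in E; lra).
set (p := fun z => ((f' z * / G z + - RtoC beta) * / b)%C).
assert (Hp : holo1 p).
{ apply holo1_mult; [|apply holo1_const]. apply holo1_plus; [|apply holo1_const].
  apply holo1_mult; [exact (disc_series_holo1 _ _ Df')|].
  apply holo1_inv; [exact (disc_series_holo1 _ _ DG)|exact NG]. }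
assert (Pp : forall z, punctured z -> 0 <= Re (p z)).
{ intros z Hz. specialize (Hst z (proj2 Hz)). unfold starlike_quotient in Hst.
  destruct (Ceq_dec z 0) as [E|N]; [destruct (punctured_neq_0 z Hz E)|].
  rewrite (disc_series_C_derive a f f' z Df Df' (proj2 Hz)), EfG in Hst by exact Hz.
  replace (z * f' z / (z * G z))%C with (f' z * / G z)%C in Hst
    by (field; split; auto).
  unfold p, b. rewrite <- RtoC_inv by lra. rewrite re_scal_r, re_plus, re_opp, re_RtoC.
  apply Rmult_le_pos; [lra|]. apply Rlt_le, Rinv_0_lt_compat. lra. }
set (C1 := a 2%nat). set (C2 := (2 * a 3%nat - a 2%nat ^ 2)%C).
set (C3 := (3 * a 4%nat - 3 * a 2%nat * a 3%nat + a 2%nat ^ 3)%C).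
assert (HO : bigO 4 (fun z => p z + - (1 + (2 * (C1 * / b * / 2)) * z
   + (C2 * / b) * z ^ 2 + (C3 * / b) * z ^ 3))%C).
{ assert (OG := disc_series_expansion _ _ DG).
  assert (Of := disc_series_expansion _ _ Df').
  cbv beta in OG, Of. rewrite A1 in OG, Of.
  set (P3 := fun z => (1 + C1 * z + C2 * z ^ 2 + C3 * z ^ 3)%C).
  (* The expansion is cross-multiplied by [G], so that only power series are compared; dividing by
     [G] afterwards costs a bounded factor. *)
  assert (ON : bigO 4 (fun z => f' z + (- P3 z) * G z)%C).
  { apply (bigO_ext 4 (fun z => (f' z + - (RtoC (INR 1) * 1 + RtoC (INR 2) * a 2%nat * z
        + RtoC (INR 3) * a 3%nat * z ^ 2 + RtoC (INR 4) * a 4%nat * z ^ 3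
        + RtoC (INR 5) * a 5%nat * z ^ 4))
      + (G z + - (1 + a 2%nat * z + a 3%nat * z ^ 2 + a 4%nat * z ^ 3
        + a 5%nat * z ^ 4)) * ((- (1)) * P3 z)
      (* Terms of degree 4 to 7 of the truncated f' - P3 G; 4 a_5 is 5 a_5 from f' minus a_5 from
         G. *)
      + z ^ 4 * (4 * a 5%nat - C1 * a 4%nat - C2 * a 3%nat - C3 * a 2%nat
         + (- (1)) * (C1 * a 5%nat + C2 * a 4%nat + C3 * a 3%nat) * z
         + (- (1)) * (C2 * a 5%nat + C3 * a 4%nat) * z ^ 2
         + (- (1)) * (C3 * a 5%nat) * z ^ 3))%C).
    - intros z _. unfold P3, C1, C2, C3.
      rewrite !INR_IZR_INZ. simpl IZR. ring.
    - apply bigO_plus; [apply bigO_plus|].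
      + apply (bigO_weaken 5); [lia|exact Of].
      + apply bigO_0_mult_r; [apply (bigO_weaken 5); [lia|exact OG]|].
        unfold P3. bigO_poly.
      + apply bigO_pow_mult. unfold Cminus. bigO_poly. }
  assert (OI : bigO 0 (fun z => / G z)%C).
  { apply bigO_0_inv. apply (bigO_ext 1 (fun z => z ^ 1 * G2 z)%C).
    - intros z [_ Hz]. rewrite EG2, A1 by exact Hz. simpl. ring.
    - apply bigO_pow_mult. exact (disc_series_bigO_0 _ _ DG2). }
  apply (bigO_ext 4 (fun z => (f' z + (- P3 z) * G z) * / G z * / b)%C).
  - intros z Hz. unfold p, P3.
    replace (RtoC beta) with (1 - b)%C
      by (unfold b; rewrite RtoC_minus; ring).
    field. repeat split; first [exact Nb|apply NG; exact Hz|intros E; apply RtoC_inj in E; lra].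
  - apply bigO_0_mult_r; [|apply bigO_const].
    apply bigO_0_mult_r; [exact ON|exact OI]. }
assert (HT := caratheodory_toeplitz p _ _ _ Hp Pp HO).
destruct (libera_zlotkiewicz _ _ _ HT) as [Hs [x [Z [Hx [HZ [E2 E3]]]]]].
exists (C1 * / b * / 2)%C, x, Z. repeat split; try assumption.
- unfold C1. field. exact Nb.
- rewrite <- E2. unfold C2, C1. field. exact Nb.
- rewrite <- E3. unfold C3, C1. field. exact Nb.
Qed.

(** * Coefficients of the inverse function *)

Lemma bigO_1_const (c : C) : bigO 1 (fun _ => c) -> c = 0%C.
Proof.
intros [K [d [Hd H]]]. apply Cmod_eq_0. apply cond_eq. intros eps He.
rewrite Rminus_0_r, Rabs_pos_eq by apply Cmod_ge_0.
assert (K0 : 0 <= Rabs K) by apply Rabs_pos.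
set (e := Rmin (d / 2) (eps / (2 * (Rabs K + 1)))).
assert (E0 : 0 < e) by (apply Rmin_glb_lt; [lra|]; apply Rdiv_lt_0_compat; lra).
assert (E1 : e <= d / 2) by apply Rmin_l.
assert (E2 : e <= eps / (2 * (Rabs K + 1))) by apply Rmin_r.
apply Rle_div_r in E2; [|lra].
specialize (H (RtoC e)). rewrite Cmod_R, Rabs_pos_eq in H by lra.
specialize (H ltac:(lra)). assert (K <= Rabs K) by apply Rle_abs. simpl in H. nra.
Qed.

(** Coefficients are read off one at a time: once the leading one is known to vanish, a power of z
    can be cancelled. *)
Lemma bigO_const_coef (n : nat) (c : C) (H : C -> C) :
  (0 < n)%nat -> bigO n (fun z => c + z ^ 1 * H z)%C -> bigO 0 H -> c = 0%C.
Proof.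
intros Hn HO HH. apply bigO_1_const.
apply (bigO_ext 1 (fun z => (c + z ^ 1 * H z) + z ^ 1 * H z * (- (1)))%C).
- intros z _. ring.
- apply bigO_plus; [apply (bigO_weaken n); assumption|].
  apply bigO_0_mult_r; [|apply bigO_const]. apply bigO_pow_mult, HH.
Qed.

(** As [bigO] says nothing at 0, the estimate of [F] can be used at [g w] only where [g w] is
    nonzero. *)
Lemma bigO_comp (n : nat) (F g : C -> C) (r : R) :
  0 < r -> (forall w, 0 < Cmod w < r -> g w <> 0%C) ->
  bigO 1 g -> bigO n F -> bigO n (fun w => F (g w)).
Proof.
intros Hr Hg [L [e [He HL]]] [K [d [Hd HK]]].
assert (L0 : 0 <= Rabs L) by apply Rabs_pos.
exists (Rabs K * (Rabs L + 1) ^ n), (Rmin r (Rmin e (d / (Rabs L + 1)))). split.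
- repeat apply Rmin_glb_lt; try assumption. apply Rdiv_lt_0_compat; lra.
- intros w [Hw0 Hw].
  assert (B1 := Rlt_le_trans _ _ _ Hw (Rmin_l _ _)).
  assert (B2 := Rlt_le_trans _ _ _ Hw (Rmin_r _ _)).
  assert (B3 := Rlt_le_trans _ _ _ B2 (Rmin_l _ _)).
  assert (B4 := Rlt_le_trans _ _ _ B2 (Rmin_r _ _)).
  apply Rlt_div_r in B4; [|lra].
  assert (B5 := HL w (conj Hw0 B3)). rewrite pow_1 in B5.
  assert (B6 : Cmod (g w) <= (Rabs L + 1) * Cmod w).
  { assert (L <= Rabs L) by apply Rle_abs. nra. }
  assert (B7 : 0 < Cmod (g w)) by (apply Cmod_gt_0, Hg; lra).
  eapply Rle_trans; [apply HK; lra|].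
  rewrite Rmult_assoc, <- Rpow_mult_distr.
  apply Rle_trans with (Rabs K * Cmod (g w) ^ n).
  + apply Rmult_le_compat_r; [apply pow_le; lra|apply Rle_abs].
  + apply Rmult_le_compat_l; [apply Rabs_pos|]. apply pow_incr. lra.
Qed.

(** F - G divides F^k - G^k with a cofactor bounded near 0. *)
Lemma bigO_pow_diff (n k : nat) (F G : C -> C) :
  bigO 0 F -> bigO 0 G -> bigO n (fun z => F z + - G z)%C ->
  bigO n (fun z => F z ^ k + - G z ^ k)%C.
Proof.
intros HF HG H.
assert (HGk : forall j, bigO 0 (fun z => G z ^ j)%C).
{ induction j as [|j IH]; [apply (bigO_const 1)|].
  exact (bigO_0_mult G _ HG IH). }
induction k as [|k IH].
- apply (bigO_ext n (fun z => (F z + - G z) * 0)%C); [intros; simpl; ring|].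
  apply bigO_0_mult_r; [exact H|apply bigO_const].
- apply (bigO_ext n (fun z => (F z ^ k + - G z ^ k) * F z + (F z + - G z) * G z ^ k)%C).
  + intros z _. simpl. ring.
  + apply bigO_plus; apply bigO_0_mult_r; auto.
Qed.

Lemma inverse_coefficients (f g : C -> C) (a b : nat -> C) :
  normalized_expansion f a -> normalized_expansion g b -> inverse_continuation f g ->
  b 2%nat = (- a 2%nat)%C /\
  b 3%nat = (2 * a 2%nat ^ 2 - a 3%nat)%C /\
  b 4%nat = (- 5 * a 2%nat ^ 3 + 5 * a 2%nat * a 3%nat - a 4%nat)%C.
Proof.
intros Ha Hb [_ [r [Hr Hinv]]].
assert (Df := normalized_expansion_disc_series f a Ha).
assert (Dg := normalized_expansion_disc_series g b Hb).
assert (Of := disc_series_expansion a f Df).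
assert (Og := disc_series_expansion b g Dg).
rewrite (proj1 Ha), (proj1 (proj2 Ha)) in Of.
rewrite (proj1 Hb), (proj1 (proj2 Hb)) in Og.
set (a2 := a 2%nat) in *. set (a3 := a 3%nat) in *. set (a4 := a 4%nat) in *.
set (b2 := b 2%nat) in *. set (b3 := b 3%nat) in *. set (b4 := b 4%nat) in *.
(* [Q] truncates [g] at degree 4; the factor is written [w ^ 1] so that [bigO_pow_mult] applies. *)
set (Q := fun w => (w ^ 1 * (1 + b2 * w + b3 * w ^ 2 + b4 * w ^ 3))%C).
assert (OgQ : bigO 5 (fun w => g w + - Q w)%C).
{ refine (bigO_ext 5 _ _ _ Og). intros z _. unfold Q. ring. }
assert (OQ : bigO 1 Q) by (apply bigO_pow_mult; bigO_poly).
assert (Og1 : bigO 1 g).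
{ apply (bigO_ext 1 (fun w => (g w + - Q w) + Q w)%C); [intros; ring|].
  apply bigO_plus; [apply (bigO_weaken 5); [lia|exact OgQ]|exact OQ]. }
assert (Dr : forall w, 0 < Cmod w < Rmin r 1 -> in_disc w /\ Cmod w < r).
{ intros w [_ Hw]. split.
  - exact (Rlt_le_trans _ _ _ Hw (Rmin_r _ _)).
  - exact (Rlt_le_trans _ _ _ Hw (Rmin_l _ _)). }
assert (Hg : forall w, 0 < Cmod w < Rmin r 1 -> g w <> 0%C).
{ intros w Hw E. destruct (Dr w Hw) as [W1 W2].
  destruct (Hinv w W1 W2) as [_ E2].
  rewrite E, (normalized_expansion_0 f a Ha) in E2.
  rewrite <- E2, Cmod_0 in Hw. lra. }
assert (Hr1 : 0 < Rmin r 1) by (apply Rmin_glb_lt; lra).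
assert (Oc := bigO_comp 5 _ g (Rmin r 1) Hr1 Hg Og1 Of). simpl in Oc.
assert (Ogk : forall k, bigO 5 (fun w => g w ^ k + - Q w ^ k)%C).
{ intros k. apply bigO_pow_diff; [| |exact OgQ]; apply (bigO_weaken 1); (lia || assumption). }
(* The coefficients of w^2, w^3, w^4 in f(g(w)), which vanish because f(g(w)) = w near 0. *)
set (e2 := (a2 + b2)%C). set (e3 := (b3 + 2 * a2 * b2 + a3)%C).
set (e4 := (b4 + a2 * (2 * b3 + b2 ^ 2) + 3 * a3 * b2 + a4)%C).
assert (OP : bigO 5 (fun w => w + - (Q w + a2 * Q w ^ 2 + a3 * Q w ^ 3 + a4 * Q w ^ 4))%C).
{ assert (O1 : bigO 5 (fun w => f (g w) + - (Q w + a2 * Q w ^ 2 + a3 * Q w ^ 3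
      + a4 * Q w ^ 4))%C).
  { refine (bigO_ext 5 _ _ _ (bigO_plus 5 _ _ (bigO_plus 5 _ _ (bigO_plus 5 _ _
      (bigO_plus 5 _ _ Oc (Ogk 1%nat)) (bigO_0_scal_const 5 a2 _ (Ogk 2%nat)))
      (bigO_0_scal_const 5 a3 _ (Ogk 3%nat))) (bigO_0_scal_const 5 a4 _ (Ogk 4%nat)))).
    intros z _. simpl. ring. }
  destruct O1 as [K [d [Hd HK]]]. exists K, (Rmin d (Rmin r 1)).
  split; [apply Rmin_glb_lt; assumption|]. intros w [Hw0 Hw].
  assert (B1 := Rlt_le_trans _ _ _ Hw (Rmin_l _ _)).
  assert (B2 := Rlt_le_trans _ _ _ Hw (Rmin_r _ _)).
  destruct (Dr w (conj Hw0 B2)) as [W1 W2].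
  destruct (Hinv w W1 W2) as [_ E2].
  rewrite <- E2 at 1. apply HK. lra. }
(* Q w + a2 (Q w)^2 + a3 (Q w)^3 + a4 (Q w)^4 = w + e2 w^2 + e3 w^3 + e4 w^4 + w^5 T w *)
set (u := fun w => (b3 + b4 * w)%C). set (v := fun w => (b2 + b3 * w + b4 * w ^ 2)%C).
set (q := fun w => (1 + w * v w)%C).
set (T := fun w => (a2 * ((2 * b4 + 2 * b2 * b3) + (2 * b2 * b4 + b3 ^ 2) * w
     + 2 * b3 * b4 * w ^ 2 + b4 ^ 2 * w ^ 3)
   + a3 * (u w * (q w * q w + q w + 1) + b2 * (v w * (q w + 2)))
   + a4 * (v w * (q w * (q w * q w) + q w * q w + q w + 1)))%C).
assert (OT : bigO 0 T).
{ unfold T, q, u, v. bigO_poly. }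
assert (O2 : bigO 3 (fun w => e2 + w ^ 1 * (e3 + w ^ 1 * e4))%C).
{ apply (bigO_div_pow 3 2).
  apply (bigO_ext 5 (fun w => (w + - (Q w + a2 * Q w ^ 2 + a3 * Q w ^ 3 + a4 * Q w ^ 4))
      * (- (1)) + w ^ 5 * T w * (- (1)))%C).
  - intros w _. unfold Q, T, q, u, v, e2, e3, e4. ring.
  - apply bigO_plus; apply bigO_0_scal_const; [exact OP|]. apply bigO_pow_mult, OT. }
assert (E2 : e2 = 0%C).
{ apply (bigO_const_coef 3 e2 (fun w => e3 + w ^ 1 * e4)%C); [lia|exact O2|]. bigO_poly. }
assert (O3 : bigO 2 (fun w => e3 + w ^ 1 * e4)%C).
{ apply (bigO_div_pow 2 1). refine (bigO_ext 3 _ _ _ O2).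
  intros w _. rewrite E2. ring. }
assert (E3 : e3 = 0%C).
{ apply (bigO_const_coef 2 e3 (fun _ => e4)); [lia|exact O3|apply bigO_const]. }
assert (E4 : e4 = 0%C).
{ apply bigO_1_const. apply (bigO_div_pow 1 1). refine (bigO_ext 2 _ _ _ O3).
  intros w _. rewrite E3. ring. }
assert (F2 : b2 = (- a2)%C) by (transitivity (e2 - a2)%C; [unfold e2|rewrite E2]; ring).
assert (F3 : b3 = (2 * a2 ^ 2 - a3)%C).
{ transitivity (e3 - 2 * a2 * b2 - a3)%C; [unfold e3; ring|]. rewrite E3, F2. ring. }
repeat split; try assumption.
transitivity (e4 - a2 * (2 * b3 + b2 ^ 2) - 3 * a3 * b2 - a4)%C; [unfold e4; ring|].
rewrite E4, F3, F2. ring.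
Qed.

(** * The second Hankel determinant *)

(** The coefficients of g being polynomials in those of f, subtracting its relations from those of f
    isolates a_3 and then a_4. The six summands are the pieces to which the triangle inequality will
    be applied. *)
Lemma hankel_identity (b m : R) (s x y Z W a2 a3 a4 : C) :
  a2 = (RtoC b * (2 * s))%C ->
  (2 * a3 - a2 ^ 2 = RtoC b * (2 * s ^ 2 + 2 * RtoC m * x))%C ->
  (3 * a4 - 3 * a2 * a3 + a2 ^ 3 = RtoC b * (2 * s ^ 3 + 4 * RtoC m * s * x
      - 2 * RtoC m * Cconj s * x ^ 2 + Z))%C ->
  (2 * (2 * a2 ^ 2 - a3) - (- a2) ^ 2 = RtoC b * (2 * s ^ 2 + 2 * RtoC m * y))%C ->
  (3 * (- 5 * a2 ^ 3 + 5 * a2 * a3 - a4) - 3 * (- a2) * (2 * a2 ^ 2 - a3) + (- a2) ^ 3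
     = RtoC b * (- (2 * s ^ 3) - 4 * RtoC m * s * y
      + 2 * RtoC m * Cconj s * y ^ 2 + W))%C ->
  (a2 * a4 - a3 * a3 = RtoC (b ^ 2) *
     (RtoC (4 / 3 - 16 / 3 * b ^ 2) * s ^ 4
      + RtoC (b * m) * (s ^ 2 * (x - y))
      + RtoC (4 / 3 * m) * (s ^ 2 * (x + y))
      + RtoC (- (2 / 3 * m)) * (s * Cconj s * (x ^ 2 + y ^ 2))
      + RtoC (1 / 3) * (s * (Z - W))
      + RtoC (- (m ^ 2 / 4)) * (x - y) ^ 2))%C.
Proof.
intros E2 E3 E4 F3 F4.
set (B := RtoC b) in *. set (M := RtoC m) in *.
(* The difference of the second-order relations is 4 (a_3 - a_2^2). *)
assert (A3 : a3 = (a2 ^ 2 + B * M * (x - y) / 2)%C).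
{ transitivity (a2 ^ 2
    + ((2 * a3 - a2 ^ 2) - (2 * (2 * a2 ^ 2 - a3) - (- a2) ^ 2)) / 4)%C; [field|].
  rewrite E3, F3. field. }
(* The difference of the third-order relations is 6 a_4 - 15 a_2 a_3 + 11 a_2^3. *)
assert (A4 : a4 = ((B * (2 * s ^ 3 + 4 * M * s * x - 2 * M * Cconj s * x ^ 2 + Z)
   - B * (- (2 * s ^ 3) - 4 * M * s * y + 2 * M * Cconj s * y ^ 2 + W)
   + 15 * a2 * a3 - 11 * a2 ^ 3) / 6)%C).
{ rewrite <- E4, <- F4. field. }
rewrite A4, A3, E2.
unfold Rdiv. rewrite ?RtoC_opp, ?RtoC_minus, ?RtoC_mult, ?RtoC_inv, ?RtoC_pow by lra.
fold B M. rewrite ?RtoC_opp, ?RtoC_minus, ?RtoC_mult, ?RtoC_inv, ?RtoC_pow by lra.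
fold B M. field.
Qed.

(* Here k stands for |c_1| / 2. *)
Definition hankel_majorant (b k : R) : R :=
  (16 * b ^ 2 - 6 * b - 5) / 3 * k ^ 4 + 2 * (b + 1) * k ^ 2 + 1.

(** X and Y stand for |x| and |y|. The left side is largest at X = Y = 1, where it equals the
    majorant. *)
Lemma hankel_triangle (b k X Y : R) :
  0 <= b -> 0 <= k <= 1 -> 0 <= X <= 1 -> 0 <= Y <= 1 ->
  (4 / 3 + 16 / 3 * b ^ 2) * k ^ 4 + b * (1 - k ^ 2) * (k ^ 2 * (X + Y))
  + 4 / 3 * (1 - k ^ 2) * (k ^ 2 * (X + Y))
  + 2 / 3 * (1 - k ^ 2) * (k * k * (X ^ 2 + Y ^ 2))
  + 1 / 3 * (k * (2 * (1 - k ^ 2) * (1 - X ^ 2) + 2 * (1 - k ^ 2) * (1 - Y ^ 2)))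
  + (1 - k ^ 2) ^ 2 / 4 * (X + Y) ^ 2
  <= hankel_majorant b k.
Proof.
intros Hb Hk HX HY. unfold hankel_majorant. set (m := 1 - k ^ 2).
assert (Hm : 0 <= m) by (unfold m; nra).
set (S := X + Y).
assert (HS : 0 <= S <= 2) by (unfold S; lra).
(* Convexity replaces X^2 + Y^2 by S^2/2: its coefficient is nonpositive. *)
assert (Q1 : 0 <= m * (k * (1 - k)) * (X ^ 2 + Y ^ 2 - S ^ 2 / 2)).
{ apply Rmult_le_pos; [apply Rmult_le_pos; nra|].
  replace (X ^ 2 + Y ^ 2 - S ^ 2 / 2) with ((X - Y) ^ 2 / 2) by (unfold S; field).
  generalize (pow2_ge_0 (X - Y)). lra. }
assert (Q2 : 0 <= m * (b * k ^ 2) * (2 - S)).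
{ apply Rmult_le_pos; [apply Rmult_le_pos; [exact Hm|apply Rmult_le_pos; nra]|lra]. }
assert (Q3 : 0 <= m * k ^ 2 * (2 - S)) by (apply Rmult_le_pos; [apply Rmult_le_pos; nra|lra]).
assert (Q4 : 0 <= m * ((1 - k) * (3 - k)) * (4 - S ^ 2)).
{ apply Rmult_le_pos; [apply Rmult_le_pos; nra|nra]. }
assert (E : X ^ 2 + Y ^ 2 = S ^ 2 / 2 + (X ^ 2 + Y ^ 2 - S ^ 2 / 2)) by ring.
set (V := X ^ 2 + Y ^ 2 - S ^ 2 / 2) in *.
(* The defect from X = Y = 1 is a combination of the four nonnegative quantities above; after the
   replacement of X^2 + Y^2, the coefficient of S^2 is m (1 - k) (3 - k) / 12. *)
assert (I : (4 / 3 + 16 / 3 * b ^ 2) * k ^ 4 + b * m * (k ^ 2 * S)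
  + 4 / 3 * m * (k ^ 2 * S) + 2 / 3 * m * (k * k * (X ^ 2 + Y ^ 2))
  + 1 / 3 * (k * (2 * m * (1 - X ^ 2) + 2 * m * (1 - Y ^ 2))) + m ^ 2 / 4 * S ^ 2
  = (16 * b ^ 2 - 6 * b - 5) / 3 * k ^ 4 + 2 * (b + 1) * k ^ 2 + 1
  - 2 / 3 * (m * (k * (1 - k)) * V) - m * (b * k ^ 2) * (2 - S)
  - 4 / 3 * (m * k ^ 2 * (2 - S)) - / 12 * (m * ((1 - k) * (3 - k)) * (4 - S ^ 2))).
{ unfold V, S, m. field. }
rewrite I. lra.
Qed.

Lemma Cmod_scal_le (c : R) (w : C) (c' B : R) :
  Rabs c <= c' -> Cmod w <= B -> Cmod (RtoC c * w)%C <= c' * B.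
Proof.
intros Hc Hw. rewrite Cmod_mult, Cmod_R.
apply Rmult_le_compat; try assumption; [apply Rabs_pos|apply Cmod_ge_0].
Qed.

Lemma Cmod_minus_le (z w : C) : Cmod (z - w)%C <= Cmod z + Cmod w.
Proof. rewrite <- (Cmod_opp w). apply Cmod_triangle. Qed.

Lemma hankel_bound (b : R) (s x y Z W : C) :
  0 <= b -> Cmod s <= 1 -> Cmod x <= 1 -> Cmod y <= 1 ->
  Cmod Z <= 2 * (1 - Cmod s ^ 2) * (1 - Cmod x ^ 2) ->
  Cmod W <= 2 * (1 - Cmod s ^ 2) * (1 - Cmod y ^ 2) ->
  let m := 1 - Cmod s ^ 2 in
  Cmod (RtoC (4 / 3 - 16 / 3 * b ^ 2) * s ^ 4
      + RtoC (b * m) * (s ^ 2 * (x - y))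
      + RtoC (4 / 3 * m) * (s ^ 2 * (x + y))
      + RtoC (- (2 / 3 * m)) * (s * Cconj s * (x ^ 2 + y ^ 2))
      + RtoC (1 / 3) * (s * (Z - W))
      + RtoC (- (m ^ 2 / 4)) * (x - y) ^ 2)%C <= hankel_majorant b (Cmod s).
Proof.
intros Hb Hs Hx Hy HZ HW m.
assert (Ps := Cmod_ge_0 s). assert (Px := Cmod_ge_0 x). assert (Py := Cmod_ge_0 y).
eapply Rle_trans; [|apply (hankel_triangle b (Cmod s) (Cmod x) (Cmod y)); lra].
assert (Hm : 0 <= m) by (unfold m; nra). fold m in HZ, HW |- *.
assert (Xy := Cmod_minus_le x y). assert (Xy' := Cmod_triangle x y).
assert (Xy0 := Cmod_ge_0 (x - y)%C).
(* Arguments of the parameters are forgotten here, and so is the minus sign in 4/3 - 16/3 b^2. *)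
repeat (eapply Rle_trans; [apply Cmod_triangle|]; apply Rplus_le_compat).
- apply Cmod_scal_le; [|rewrite Cmod_pow; lra].
  assert (0 <= b ^ 2) by nra. apply Rabs_le. lra.
- apply Cmod_scal_le; [rewrite Rabs_pos_eq; nra|].
  rewrite Cmod_mult, Cmod_pow. apply Rmult_le_compat_l; [nra|exact Xy].
- apply Cmod_scal_le; [rewrite Rabs_pos_eq; lra|].
  rewrite Cmod_mult, Cmod_pow. apply Rmult_le_compat_l; [nra|exact Xy'].
- apply Cmod_scal_le; [rewrite Rabs_Ropp, Rabs_pos_eq; lra|].
  rewrite !Cmod_mult, Cmod_conj, <- !Cmod_pow.
  apply Rmult_le_compat_l; [nra|apply Cmod_triangle].
- apply Cmod_scal_le; [rewrite Rabs_pos_eq; lra|].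
  rewrite Cmod_mult. apply Rmult_le_compat_l; [lra|].
  generalize (Cmod_minus_le Z W). lra.
- apply Cmod_scal_le; [rewrite Rabs_Ropp, Rabs_pos_eq; nra|].
  rewrite Cmod_pow. apply pow_incr. lra.
Qed.

(** In t = k^2 the slope is affine and nonnegative at both ends of [0, 1], hence throughout, so t =
    1 is the maximum. *)
Lemma hankel_majorant_le_end (b k : R) :
  0 < b -> 0 <= k <= 1 -> 0 <= 16 * b ^ 2 - 3 * b - 2 ->
  hankel_majorant b k <= 4 / 3 * (4 * b ^ 2 + 1).
Proof.
intros Hb Hk H. unfold hankel_majorant.
assert (Hk2 : 0 <= k ^ 2 <= 1) by nra.
replace (k ^ 4) with (k ^ 2 * k ^ 2) by ring. set (t := k ^ 2) in *. clearbody t.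
(* Three times the gap: 1 - t divides it, and the other factor, affine in t, is interpolated between
   its end values 16 b^2 + 1 and 2 (16 b^2 - 3 b - 2). *)
assert (0 <= (1 - t) * (t * (2 * (16 * b ^ 2 - 3 * b - 2)) + (1 - t) * (16 * b ^ 2 + 1))).
{ apply Rmult_le_pos; [lra|]. apply Rplus_le_le_0_compat; apply Rmult_le_pos; nra. }
lra.
Qed.

(** Completing the square: with a negative leading coefficient the square only lowers the value,
    whatever k is. *)
Lemma hankel_majorant_le_vertex (b k : R) :
  16 * b ^ 2 - 6 * b - 5 < 0 ->
  hankel_majorant b k <= 1 - 3 * (b + 1) ^ 2 / (16 * b ^ 2 - 6 * b - 5).
Proof.
intros H. unfold hankel_majorant. set (D := 16 * b ^ 2 - 6 * b - 5) in *. clearbody D.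
replace (D / 3 * k ^ 4 + 2 * (b + 1) * k ^ 2 + 1) with
  (1 - 3 * (b + 1) ^ 2 / D + D / 3 * (k ^ 2 + 3 * (b + 1) / D) ^ 2) by (field; lra).
assert (0 <= (k ^ 2 + 3 * (b + 1) / D) ^ 2) by apply pow2_ge_0.
nra.
Qed.

Theorem theorem2p1 (beta : R) (f : C -> C) (a : nat -> C)
  (hbeta : 0 <= beta < 1)
  (hf : bi_starlike beta f)
  (ha : normalized_expansion f a) :
  (0 <= beta <= (29 - sqrt 137) / 32 ->
     Cmod (a 2%nat * a 4%nat - a 3%nat * a 3%nat)%C
       <= 4 / 3 * (1 - beta) ^ 2 * (4 * beta ^ 2 - 8 * beta + 5)) /\
  ((29 - sqrt 137) / 32 < beta < 1 ->
     Cmod (a 2%nat * a 4%nat - a 3%nat * a 3%nat)%C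
       <= (1 - beta) ^ 2 *
          ((13 * beta ^ 2 - 14 * beta - 7) / (16 * beta ^ 2 - 26 * beta + 5))).
Proof.
destruct hf as [_ [Sf [g [Hfg Sg]]]].
assert (Bg : exists bb, normalized_expansion g bb) by (destruct Sg as [[[_ H] _] _]; exact H).
destruct Bg as [bb Hbb].
destruct (inverse_coefficients f g a bb ha Hbb Hfg) as [I2 [I3 I4]].
set (b := 1 - beta).
assert (Hb : 0 < b) by (unfold b; lra).
destruct (starlike_coefficients beta f a ltac:(lra) Sf ha)
  as [s [x [Z [Hs [Hx [HZ [E2 [E3 E4]]]]]]]].
destruct (starlike_coefficients beta g bb ltac:(lra) Sg Hbb)
  as [s' [y [W [_ [Hy [HW [F2 [F3 F4]]]]]]]].
fold b in E2, E3, E4, F2, F3, F4.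
assert (Nb : RtoC b <> 0%C) by (intros E; apply RtoC_inj in E; lra).
(* Because b_2 = -a_2, the two parameters are opposite, so f and g share the same [m]. *)
assert (Es : s' = (- s)%C).
{ transitivity (bb 2%nat / (2 * RtoC b))%C; [rewrite F2; field; exact Nb|].
  rewrite I2, E2. field. exact Nb. }
subst s'. rewrite Cmod_opp in HW, F3, F4. rewrite I2, I3 in F3. rewrite I2, I3, I4 in F4.
set (m := 1 - Cmod s ^ 2) in *.
assert (Main : Cmod (a 2%nat * a 4%nat - a 3%nat * a 3%nat)%C
   <= b ^ 2 * hankel_majorant b (Cmod s)).
{ rewrite (hankel_identity b m s x y Z W _ _ _ E2 E3 E4).
  - rewrite Cmod_mult, Cmod_R, Rabs_pos_eq by nra.
    apply Rmult_le_compat_l; [nra|].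
    apply (hankel_bound b s x y Z W); try assumption. lra.
  - rewrite F3. ring.
  - rewrite F4, Copp_conj. ring. }
assert (Hq : sqrt 137 * sqrt 137 = 137) by (apply sqrt_sqrt; lra).
assert (Hq0 : 0 <= sqrt 137) by apply sqrt_pos.
assert (Hk : 0 <= Cmod s <= 1) by (split; [apply Cmod_ge_0|exact Hs]).
split; intros Hc.
- assert (Hroot : 0 <= 16 * b ^ 2 - 3 * b - 2).
  (* The larger root (3 + sqrt 137) / 32 is 1 minus the break point in beta. *)
  { replace (16 * b ^ 2 - 3 * b - 2) with
      (16 * (b - (3 + sqrt 137) / 32) * (b - (3 - sqrt 137) / 32)) by nra.
    apply Rmult_le_pos; unfold b; lra. }
  assert (H := hankel_majorant_le_end b (Cmod s) Hb Hk Hroot).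
  eapply Rle_trans; [exact Main|].
  apply Rle_trans with (b ^ 2 * (4 / 3 * (4 * b ^ 2 + 1))).
  + apply Rmult_le_compat_l; [nra|exact H].
  + apply Req_le. unfold b. ring.
- assert (Hroot : 16 * b ^ 2 - 3 * b - 2 < 0).
  { assert (11 < sqrt 137) by nra.
    replace (16 * b ^ 2 - 3 * b - 2) with
      (16 * (b - (3 + sqrt 137) / 32) * (b - (3 - sqrt 137) / 32)) by nra.
    assert (b - (3 + sqrt 137) / 32 < 0) by (unfold b; lra).
    assert (0 < b - (3 - sqrt 137) / 32) by lra. nra. }
  (* It equals (16 b^2 - 3 b - 2) - 3 (b + 1); in terms of beta it is the denominator 16 beta^2 - 26
     beta + 5. *)
  assert (HD : 16 * b ^ 2 - 6 * b - 5 < 0) by lra.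
  assert (H := hankel_majorant_le_vertex b (Cmod s) HD).
  replace ((13 * beta ^ 2 - 14 * beta - 7) / (16 * beta ^ 2 - 26 * beta + 5)) with
    (1 - 3 * (b + 1) ^ 2 / (16 * b ^ 2 - 6 * b - 5)).
  + eapply Rle_trans; [exact Main|]. apply Rmult_le_compat_l; [nra|exact H].
  + unfold b in *. field. lra.
Qed.
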